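(* For every integer $n\geq 1$, the full arc complex $\mathcal{A}(\mathcal{P}_n^{\times})$ of the crown $\mathcal{P}_n^{\times}$ with $n$ boundary vertices is strongly collapsible.
   Context: Surface. For $n\ge 1$, the (orientable) crown $\mathcal{P}_n^{\times}$ is a closed disk with $n$ distinct marked points on its boundary, labeled $1,\dots,n$ in cyclic order, and one marked point in its interior labeled $0$. The marked points are called vertices; the portion of the boundary between two consecutive boundary vertices is an edge (for $n=1$, the single edge is the whole boundary circle). Arcs. A simple arc is an arc in the surface whose two endpoints are vertices (possibly the same vertex), which is embedded except that its endpoints may coincide, and whose interior avoids the boundary of the surface and all vertices. Homotopies of arcs are relative to endpoints, with the interior of the arc avoiding the vertices (in particular the interior marked point $0$). An arc is trivial if it is homotopic, relative to its endpoints, to a vertex or to an edge. Only simple non-trivial arcs are considered. Two homotopy classes are disjoint if they have representatives that are disjoint (except possibly at endpoints). Arc complex. The full arc complex $\mathcal{A}(S)$ of a surface $S$ is the simplicial complex whose 0-simplices are the homotopy classes of all simple non-trivial arcs, and whose $k$-simplices ($k\ge1$) are the sets of $k+1$ pairwise disjoint and distinct homotopy classes. Strong collapse. A 0-simplex $v$ of a simplicial complex $X$ is vertex-dominated if there is another 0-simplex $v'$ such that the link of $v$ in $X$ is a join $v'*L$ for some subcomplex $L$ of $X$ (equivalently, every maximal simplex containing $v$ contains $v'$; $L$ may be the empty complex). In that case $X$ strongly collapses onto $X\smallsetminus\{v\}:=\{\eta\in X\mid v\notin\eta\}$. A finite complex is strongly collapsible if some finite sequence of strong collapses reduces it to a single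 0-simplex. *)

(* Defs.v *)
From mathcomp Require Import all_boot all_order all_algebra.
From mathcomp Require Import all_classical all_reals all_analysis.

Set Implicit Arguments.
Unset Strict Implicit.
Unset Printing Implicit Defensive.

Import Order.TTheory GRing.Theory Num.Theory.
Import numFieldNormedType.Exports.

Local Open Scope classical_set_scope.
Local Open Scope ring_scope.

(* The empty set is not a simplex here, and [set0] is the empty complex. *)
Record simplicial_complex (V : Type) := SimplicialComplex {
  simplex : set (set V);
  simplex_finite : forall s, simplex s -> finite_set s;
  simplex_nonempty : forall s, simplex s -> s !=set0;
  simplex_face : forall s t, simplex s -> t `<=` s -> t !=set0 -> simplex t
}.

Section Collapse.
Context {V : Type}.
Implicit Types (X L : simplicial_complex V) (v : V).

Definition zero_simplex X v := simplex X [set v].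

Definition point_complex v : set (set V) := [set [set v]].

Definition link X v : set (set V) :=
  [set s | s !=set0 /\ ~ s v /\ simplex X (v |` s)].

(* Only meant for K and L without common vertices. *)
Definition join (K L : set (set V)) : set (set V) :=
  K `|` L `|` [set s `|` t | s in K & t in L].

Definition dominated X v :=
  zero_simplex X v /\
  exists v', [/\ v' <> v, zero_simplex X v' &
    exists L, [/\ simplex L `<=` simplex X, ~ zero_simplex L v' &
      link X v = join (point_complex v') (simplex L)]].

Program Definition deletion X v : simplicial_complex V :=
  @SimplicialComplex V [set s | simplex X s /\ ~ s v] _ _ _.
Next Obligation. by move=> X v s [/simplex_finite]. Qed.
Next Obligation. by move=> X v s [/simplex_nonempty]. Qed.
Next Obligation.
move=> X v s t [Xs sv] ts t0; split; first exact: simplex_face ts t0.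
by move=> /ts.
Qed.

(* Finiteness of X is not a separate requirement: each step deletes a single
   0-simplex, so only finite complexes satisfy this predicate. *)
Inductive strongly_collapsible X : Prop :=
| collapsible_point v of simplex X = point_complex v
| collapsible_step v of dominated X v & strongly_collapsible (deletion X v).

End Collapse.

Section Crown.
Context {R : realType}.
Variable n : nat.
Local Notation plane := (R * R)%type.
Implicit Types (p : plane) (g d : R -> plane) (c : set (R -> plane)).

Definition disk : set plane := [set p | p.1 ^+ 2 + p.2 ^+ 2 <= 1].
Definition circle : set plane := [set p | p.1 ^+ 2 + p.2 ^+ 2 = 1].

Definition circle_point (a : R) : plane := (cos a, sin a).

(* The crown is modelled on the unit disk, with vertex 0 at the origin and
   vertices 1, ..., n at the n-th roots of unity; label n.+1 is label 1. *)
Definition boundary_vertex (k : nat) : plane :=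
  circle_point (2 * pi * k%:R / n%:R).

Definition vertex : set plane :=
  [set p | p = (0, 0) \/ exists2 k, (1 <= k <= n)%N & p = boundary_vertex k].

(* The edge from vertex k to the next one, for 1 <= k <= n. *)
Definition edge (k : nat) (t : R) : plane :=
  circle_point (2 * pi * (k%:R + t) / n%:R).

(* Paths are parametrized by [0, 1]; values elsewhere are irrelevant. *)
Definition simple_arc g :=
  [/\ {within `[0, 1], continuous g},
      vertex (g 0) /\ vertex (g 1),
      forall t : R, t \in `]0, 1[ -> disk (g t) /\ ~ circle (g t) /\ ~ vertex (g t)
    & forall s t : R, s \in `[0, 1] -> t \in `[0, 1] -> s < t -> g s = g t ->
        s = 0 /\ t = 1].

(* The interior of the moving path avoids the vertices at all intermediate
   times. At times 0 and 1 this is a property of g and d themselves: it holds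
   for arcs and edges, and fails for a constant path at a vertex, which must
   nevertheless be allowed as the end of a homotopy. *)
Definition homotopic g d :=
  exists H : R * R -> plane,
  [/\ {within `[0, 1] `*` `[0, 1], continuous H},
      forall s t : R, s \in `[0, 1] -> t \in `[0, 1] -> disk (H (s, t)),
      forall t : R, t \in `[0, 1] -> H (0, t) = g t /\ H (1, t) = d t,
      forall s : R, s \in `[0, 1] -> H (s, 0) = g 0 /\ H (s, 1) = g 1
    & forall s t : R, s \in `]0, 1[ -> t \in `]0, 1[ -> ~ vertex (H (s, t))].

Definition reverse g (t : R) : plane := g (1 - t).

(* Arcs are unoriented. *)
Definition arc_homotopic g d := homotopic g d \/ homotopic g (reverse d).

Definition trivial_arc g :=
  (exists2 p, vertex p & homotopic g (cst p)) \/
  (exists2 k, (1 <= k <= n)%N & arc_homotopic g (edge k)).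

Definition arc_class g : set (R -> plane) :=
  [set d | simple_arc d /\ arc_homotopic g d].

Definition is_arc_class c :=
  exists g, [/\ simple_arc g, ~ trivial_arc g & c = arc_class g].

Definition disjoint_arcs g d :=
  forall s t : R, s \in `[0, 1] -> t \in `[0, 1] -> g s = d t ->
    (s = 0 \/ s = 1) /\ (t = 0 \/ t = 1).

Definition disjoint_classes c1 c2 :=
  exists g d, [/\ c1 g, c2 d & disjoint_arcs g d].

End Crown.

Program Definition arc_complex (R : realType) (n : nat) :
    simplicial_complex (set (R -> R * R)) :=
  @SimplicialComplex _
    [set s | [/\ finite_set s, s !=set0, s `<=` is_arc_class n &
       forall c1 c2, s c1 -> s c2 -> c1 <> c2 -> disjoint_classes c1 c2]]
    _ _ _.
Next Obligation. by move=> R n s []. Qed.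
Next Obligation. by move=> R n s []. Qed.
Next Obligation.
move=> R n s t [fs _ sA sD] ts t0; split => //.
- exact: sub_finite_set fs.
- exact: subset_trans sA.
- by move=> c1 c2 /ts c1s /ts c2s; exact: sD.
Qed.

(* Main.v *)
Require Import Defs.
From mathcomp Require Import all_boot all_order all_algebra.
From mathcomp Require Import all_classical all_reals all_analysis.
From mathcomp Require Import ring lra zify.

(** The arc complex of the crown is a flag complex on a finite set of classes,
    so the proof has a topological half, which finds enough of the vertices and
    edges, and a combinatorial half, which dismantles the resulting graph.

    Vertices.  A simple arc from the centre to the boundary vertex [i] can be
    retracted onto a radius ([radial_homotopic]), so there is one class
    [radial_class i] for each [i].  A loop at the centre shrinks linearly to
    the centre.  An arc between boundary vertices stays away from the centre
    and has a continuous argument ([polar_lift]); interpolating moduli and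
    arguments shows that its class is determined by its initial vertex [i] and
    by the number [k] of steps of angle 2pi/n that it turns through
    ([polar_homotopic]), and lifting a homotopy shows that [k] is an invariant
    ([winding_homotopic]).  Up to orientation [k >= 0], and [k = 0] is trivial.
    If [k > n], the lift of the arc to the universal cover of the punctured
    disk has endpoints that interleave with those of its translate by 2pi, so
    the two lifts cross, and the arc is not simple ([winding_le]).  Hence
    [1 <= k <= n], which leaves the finitely many [chord_class i k].

    Edges.  Radial classes are pairwise disjoint.  The radius at [i] misses an
    explicit representative of the chord [(j, l)] unless [i] lies strictly
    inside the interval from [j] to [j + l], modulo n.  Conversely two disjoint
    chords [(i, k)] and [(j, l)] with [l <= k] cannot have [i] strictly inside
    [(j, j + l)], since their endpoints would then interleave
    ([chords_nest]).

    Collapse.  Delete the chords by decreasing [k].  When [(i, k)] is among the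
    longest remaining chords, every remaining chord disjoint from it does not
    have [i] in its interior, hence is disjoint from the radial class at [i]:
    this class dominates the chord ([radial_dominates]).  What remains is the
    simplex of radial classes, all dominated by the first one.

    The crossing statement ([crossing]) is an argument count: if two paths
    with interleaved endpoints did not meet, their difference would be a
    nowhere zero map on the square whose argument turns by -2pi along the
    boundary, although a lift of the argument to the square exists. *)

Set Implicit Arguments.
Unset Strict Implicit.
Unset Printing Implicit Defensive.

Import Order.TTheory GRing.Theory Num.Theory.
Import numFieldNormedType.Exports.

Local Open Scope classical_set_scope.
Local Open Scope ring_scope.

(** * Dismantling a complex one vertex at a time *)

Section Dismantling.
Context {V : Type}.
Implicit Types (X Y : simplicial_complex V) (v : V).

Section Residual.
Variables (X : simplicial_complex V) (v w : V).

(** The factor [L] in the decomposition of the link of [v] as the join of [w]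
    and [L]. *)
Definition residual_simplices : set (set V) :=
  [set s | [/\ simplex X s, simplex X (v |` s), ~ s v & ~ s w]].

Lemma residual_finite s : residual_simplices s -> finite_set s.
Proof. by case=> /simplex_finite. Qed.

Lemma residual_nonempty s : residual_simplices s -> s !=set0.
Proof. by case=> /simplex_nonempty. Qed.

Lemma residual_face s t : residual_simplices s -> t `<=` s -> t !=set0 ->
  residual_simplices t.
Proof.
move=> [Xs Xvs sv sw] ts t0; split.
- exact: simplex_face ts t0.
- by apply: simplex_face Xvs _ _; [exact: setUS | exists v; left].
- by move=> /ts.
- by move=> /ts.
Qed.

Definition residual := SimplicialComplex residual_finite residual_nonempty residual_face.

End Residual.

(** Being a cone with apex [w] is the form of domination that is easy to check
    in a flag complex: each simplex through [v] can be enlarged by [w]. *)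
Lemma cone_dominated X v w : zero_simplex X v -> w <> v ->
  (forall s, simplex X s -> s v -> simplex X (w |` s)) -> dominated X v.
Proof.
move=> Xv wv cone; split => //; exists w.
have Xwv : simplex X (w |` [set v]) by exact: cone.
have Xw : zero_simplex X w.
  by apply: simplex_face Xwv _ _; [move=> x ->; left | exists w].
split => //; exists (residual X v w); split.
- by move=> s [].
- by move=> [_ _ _]; apply.
apply/seteqP; split => s.
  move=> [s0 [sv Xvs]].
  have Xs : simplex X s by apply: simplex_face Xvs _ s0; exact: subsetUr.
  have [sw|sw] := pselect (s w); last by left; right.
  have [t0|/set0P t0] := eqVneq (s `\ w) set0.
    left; left; rewrite /point_complex /=; apply/seteqP; split => [x sx|_ -> //].
    apply: contrapT => xw; have : (s `\ w) x by [].
    by rewrite t0.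
  right; exists [set w]; first by [].
  exists (s `\ w); last by rewrite setDUK //; move=> _ ->.
  split; [ | | by case | by case=> _; apply].
  - by apply: simplex_face Xs _ t0 => x [].
  - apply: simplex_face Xvs _ _; last by exists v; left.
    by apply: setUS => x [].
case=> [[->|[Xs Xvs sv sw]]|[_ -> [t [Xt Xvt tv tw] <-]]].
- by split; [exists w | split; [exact: nesym|rewrite setUC]].
- by split; [exact: simplex_nonempty Xs | split].
- split; first by exists w; left.
  split; first by case=> [/esym|].
  by rewrite setUCA; apply: cone => //; left.
Qed.

(** The vertices [f 0, f 1, ...] are deleted in turn until only [c] is left.
    Entries of [f] that are not vertices of the current complex (repetitions,
    or sets that are not vertices at all) are skipped, so that [f] may
    enumerate a convenient superset of the vertices. *)
Lemma dismantle X (f : nat -> V) (m : nat) (c : V) :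
  (forall s v, simplex X s -> s v -> v = c \/ exists2 k, (k < m)%N & v = f k) ->
  simplex X [set c] -> (forall k, (k < m)%N -> f k <> c) ->
  (forall k, (k < m)%N -> exists w, [/\ w <> f k &
     forall s, simplex X s -> (forall j, (j < k)%N -> ~ s (f j)) -> s (f k) ->
       simplex X (w |` s) /\ forall j, (j < k)%N -> w <> f j]) ->
  strongly_collapsible X.
Proof.
move=> cover Xc fc dom.
suff gen r k Y : (k + r = m)%N ->
    (forall s, simplex Y s <-> simplex X s /\ forall j, (j < k)%N -> ~ s (f j)) ->
    strongly_collapsible Y.
  by apply: (gen m 0%N) => // s; split => [|[]].
elim: r k Y => [|r IH] k Y km YE.
  rewrite addn0 in km; apply: (@collapsible_point _ _ c).
  apply/seteqP; split => s; last first.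
    move=> ->; apply/YE; split => // j jk /= e.
    by apply: (fc j); rewrite ?km // in jk *.
  move=> /YE[Xs sf]; have [x sx] := simplex_nonempty Xs.
  have all_c y : s y -> y = c.
    move=> sy; have [//|[j jm yj]] := cover s y Xs sy.
    by case: (sf j); rewrite ?km -?yj.
  by apply/seteqP; split => y /=; [exact: all_c | move=> ->; rewrite -(all_c x)].
have km' : (k < m)%N by rewrite -km -addSnnS leq_addr.
have next : (k.+1 + r = m)%N by rewrite addSnnS.
have ltS (Q : nat -> Prop) : (forall j, (j < k.+1)%N -> Q j) <->
    (forall j, (j < k)%N -> Q j) /\ Q k.
  split=> [q|[q qk] j]; first by split=> [j jk|]; apply: q => //; exact: ltnW.
  by rewrite ltnS leq_eqVlt => /predU1P[->|/q].
have [Yk|Yk] := pselect (zero_simplex Y (f k)); last first.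
  apply: (IH k.+1 Y next) => s; rewrite ltS; split=> [Ys|[Xs [sk _]]]; last exact/YE.
  have /YE[Xs sk] := Ys; split => //; split => // sfk; apply: Yk.
  by apply: simplex_face Ys _ _; [move=> x -> | exists (f k)].
apply: (@collapsible_step _ _ (f k)).
  have [w [wk cone]] := dom k km'; apply: (cone_dominated Yk wk) => s /YE[Xs sk] sfk.
  have [Xws wj] := cone s Xs sk sfk.
  by apply/YE; split => // j jk [/esym|]; [exact: wj | exact: sk].
apply: (IH k.+1 _ next) => s; rewrite ltS /=.
by split=> [[/YE[? ?] ?]|[? [? ?]]]; [split | split => //; apply/YE].
Qed.

End Dismantling.

(** * Continuity of explicit formulas *)

Section Continuity.
Context {R : realType} {T : topologicalType}.
Implicit Types f g : T -> R.

Lemma continuous_idf : continuous (fun x : T => x).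
Proof. by move=> x; exact: cvg_id. Qed.

Lemma continuous_add f g : continuous f -> continuous g ->
  continuous (fun x => f x + g x).
Proof. by move=> cf cg x; apply: cvgD; [exact: cf | exact: cg]. Qed.

Lemma continuous_opp f : continuous f -> continuous (fun x => - f x).
Proof. by move=> cf x; apply: cvgN; exact: cf. Qed.

Lemma continuous_mul f g : continuous f -> continuous g ->
  continuous (fun x => f x * g x).
Proof. by move=> cf cg x; apply: cvgM; [exact: cf | exact: cg]. Qed.

Lemma continuous_div f g : continuous f -> continuous g ->
  (forall x, g x != 0) -> continuous (fun x => f x / g x).
Proof.
by move=> cf cg g0 x; apply: cvgM; [exact: cf | apply: cvgV => //; exact: cg].
Qed.

Lemma continuous_mk_pair (U V : topologicalType) (f : T -> U) (g : T -> V) :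
  continuous f -> continuous g -> continuous (fun x => (f x, g x)).
Proof. by move=> cf cg x; apply: cvg_pair; [exact: cf | exact: cg]. Qed.

Lemma continuous_compose (U V : topologicalType) (h : U -> V) (f : T -> U) :
  continuous f -> continuous h -> continuous (fun x => h (f x)).
Proof. by move=> cf ch x; apply: continuous_comp; [exact: cf | exact: ch]. Qed.

Lemma continuous_fstf (U V : topologicalType) (f : T -> U * V) :
  continuous f -> continuous (fun x => (f x).1).
Proof. by move=> cf; apply: (continuous_compose cf) => x; exact: cvg_fst. Qed.

Lemma continuous_sndf (U V : topologicalType) (f : T -> U * V) :
  continuous f -> continuous (fun x => (f x).2).
Proof. by move=> cf; apply: (continuous_compose cf) => x; exact: cvg_snd. Qed.

Lemma continuous_cosf f : continuous f -> continuous (fun x => cos (f x)).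
Proof. by move=> cf; apply: (continuous_compose cf); exact: continuous_cos. Qed.

Lemma continuous_sinf f : continuous f -> continuous (fun x => sin (f x)).
Proof. by move=> cf; apply: (continuous_compose cf); exact: continuous_sin. Qed.

Lemma continuous_maxf f g : continuous f -> continuous g ->
  continuous (fun x => Num.max (f x) (g x)).
Proof. by move=> cf cg x; apply: continuous_max; [exact: cf | exact: cg]. Qed.

Lemma continuous_minf f g : continuous f -> continuous g ->
  continuous (fun x => Num.min (f x) (g x)).
Proof. by move=> cf cg x; apply: continuous_min; [exact: cf | exact: cg]. Qed.

Lemma continuous_sumf n (f : nat -> T -> R) : (forall i, continuous (f i)) ->
  continuous (fun x => \sum_(i < n) f i x).
Proof.
move=> cf; elim: n => [|n IH].
  under [X in continuous X]eq_fun do rewrite big_ord0; exact: cst_continuous.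
under [X in continuous X]eq_fun do rewrite big_ord_recr /=.
exact: continuous_add.
Qed.

End Continuity.

Section Clamp.
Context {R : realType}.

(** Composition with the retraction onto the unit interval turns maps that are
    continuous within [0, 1] into maps continuous everywhere. *)
Definition clamp (t : R) : R := Num.max 0 (Num.min 1 t).

Lemma clamp_bounds t : 0 <= clamp t <= 1.
Proof.
by rewrite /clamp le_max lexx /= ge_max ler01 ge_min lexx.
Qed.

Lemma clamp_id t : 0 <= t <= 1 -> clamp t = t.
Proof. by case/andP=> t0 t1; rewrite /clamp (min_idPr t1) (max_idPr t0). Qed.

Lemma continuous_clamp : continuous clamp.
Proof.
apply: continuous_maxf; first exact: cst_continuous.
apply: continuous_minf; [exact: cst_continuous | exact: continuous_idf].
Qed.

Lemma within_compose (T S U : topologicalType) (A : set S) (f : S -> U)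
    (h : T -> S) :
  {within A, continuous f} -> continuous h -> (forall x, A (h x)) ->
  continuous (fun x => f (h x)).
Proof.
move=> /subspace_continuousP cf ch hA x.
apply: cvg_trans (cf _ (hA x)).
move=> B /= wB; have := ch x _ wB.
rewrite /nbhs /=; apply: filterS => y; exact.
Qed.

Lemma continuous_within_eq (T U : topologicalType) (A : set T) (f h : T -> U) :
  continuous h -> (forall x, A x -> f x = h x) -> {within A, continuous f}.
Proof.
move=> ch fh; apply/subspace_continuousP => x Ax.
have -> : nbhs (f x) = nbhs (h x) by rewrite fh.
move=> B hB; have := ch x _ hB; rewrite /within /nbhs /=.
by apply: filterS => y By Ay; rewrite /from_subspace fh.
Qed.

Lemma continuous_clamp_path (g : R -> R * R) :
  {within `[0, 1], continuous g} -> continuous (fun t => g (clamp t)).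
Proof.
move=> cg; apply: (within_compose cg continuous_clamp) => t /=.
by rewrite in_itv /= clamp_bounds.
Qed.

End Clamp.

(** Structural search driven by the syntax of the function, which keeps
    higher-order unification trivial. *)
Ltac prove_continuous := first [match goal with H : ?P |- ?P => exact: H end | lazymatch goal with
  | |- continuous (fun x => x) => exact: continuous_idf
  | |- continuous (fun _ => ?c) => exact: cst_continuous
  | |- continuous (fun x => @?f x + @?g x) =>
      refine (@continuous_add _ _ f g _ _); prove_continuous
  | |- continuous (fun x => @?f x * @?g x) =>
      refine (@continuous_mul _ _ f g _ _); prove_continuous
  | |- continuous (fun x => - @?f x) => refine (@continuous_opp _ _ f _); prove_continuous
  | |- continuous (fun x => Num.max (@?f x) (@?g x)) =>
      refine (@continuous_maxf _ _ f g _ _); prove_continuous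
  | |- continuous (fun x => Num.min (@?f x) (@?g x)) =>
      refine (@continuous_minf _ _ f g _ _); prove_continuous
  | |- continuous (fun x => cos (@?f x)) => refine (@continuous_cosf _ _ f _); prove_continuous
  | |- continuous (fun x => sin (@?f x)) => refine (@continuous_sinf _ _ f _); prove_continuous
  | |- continuous (fun x => (@?f x, @?g x)) =>
      refine (@continuous_mk_pair _ _ _ f g _ _); prove_continuous
  | |- continuous (fun x => (@?f x).1) => refine (@continuous_fstf _ _ _ f _); prove_continuous
  | |- continuous (fun x => (@?f x).2) => refine (@continuous_sndf _ _ _ f _); prove_continuous
  | |- continuous (fun x => ?h (@?f x)) =>
      refine (@continuous_compose _ _ _ h f _ _);
        [prove_continuous | first [assumption | exact: continuous_clamp | idtac]]
  | |- continuous _ => try assumption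
  end].

(** * Continuous choice of an argument on the square *)

Section Polar.
Context {R : realType}.
Implicit Types (p u v : R * R) (a b t : R).

(** The point is nonzero and [a] is one of its arguments. *)
Definition polar p a := exists2 r : R, 0 < r & p = (r * cos a, r * sin a).

Definition dot u v : R := u.1 * v.1 + u.2 * v.2.
Definition cross u v : R := u.1 * v.2 - u.2 * v.1.

(** If the angle between [u] and [v] is acute, then the argument can be
    continued from [u] to [v] by an explicit formula, which is continuous in
    both points. *)
Lemma polar_step u v a : polar u a -> 0 < dot u v ->
  polar v (a + atan (cross u v / dot u v)).
Proof.
case=> r r0 ->; case: v => x y; rewrite /dot /cross /= => d0.
set w := atan _.
have cw : 0 < cos w by rewrite cos_gt0_pihalf // atan_gtNpi2 atan_ltpi2.
have tw : sin w = cos w * (r * cos a * y - r * sin a * x) /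
                  (r * cos a * x + r * sin a * y).
  rewrite -mulrA -[X in _ * X]atanK -/w /tan mulrCA divff ?gt_eqF //.
  by rewrite mulr1.
have d0' : r * cos a * x + r * sin a * y != 0 by rewrite gt_eqF.
have cw' : cos w != 0 by rewrite gt_eqF.
have r0' : r != 0 by rewrite gt_eqF.
have cs := cos2Dsin2 a.
exists ((r * cos a * x + r * sin a * y) / r / cos w).
  by rewrite !divr_gt0.
have ex : x = x * (cos a ^+ 2 + sin a ^+ 2) by rewrite cs mulr1.
have ey : y = y * (cos a ^+ 2 + sin a ^+ 2) by rewrite cs mulr1.
rewrite cosD sinD tw; congr pair.
  rewrite [LHS]ex; field; by rewrite cw' d0' r0'.
rewrite [LHS]ey; field; by rewrite cw' d0' r0'.
Qed.

Lemma polar_exists p : p <> (0, 0) -> exists a, polar p a.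
Proof.
case: p => x y p0.
have step u b : polar u b -> 0 < dot u (x, y) -> exists a, polar (x, y) a.
  by move=> pu d0; exists (b + atan (cross u (x, y) / dot u (x, y))); exact: polar_step.
have [x0|x0|x0] := ltgtP x 0.
- apply: (step (-1, 0) pi); last by rewrite /dot /=; lra.
  by exists 1; rewrite // cospi sinpi !mul1r.
- apply: (step (1, 0) 0); last by rewrite /dot /=; lra.
  by exists 1; rewrite // cos0 sin0 !mul1r.
have [y0|y0|y0] := ltgtP y 0.
- apply: (step (0, -1) (- (pi / 2))); last by rewrite /dot /=; lra.
  by exists 1; rewrite // cosN sinN cos_pihalf sin_pihalf !mul1r.
- apply: (step (0, 1) (pi / 2)); last by rewrite /dot /=; lra.
  by exists 1; rewrite // cos_pihalf sin_pihalf !mul1r.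
by rewrite x0 y0 in p0.
Qed.

Lemma dot_gt0 p : p <> (0, 0) -> 0 < dot p p.
Proof.
case: p => x y p0; rewrite /dot /= lt_neqAle addr_ge0 ?sqr_ge0 -?expr2 ?sqr_ge0 // andbT.
rewrite eq_sym paddr_eq0 ?sqr_ge0 // !sqrf_eq0; apply/negP => /andP[/eqP x0 /eqP y0].
by apply: p0; rewrite x0 y0.
Qed.

Definition square : set (R * R) := [set p | 0 <= p.1 <= 1 /\ 0 <= p.2 <= 1].

(** Compactness of the square times the unit interval bounds from below the
    change of scale at which the value of [F] can turn by a right angle. *)
Lemma lift_mesh (F : R * R -> R * R) : continuous F ->
  (forall p, square p -> F p <> (0, 0)) ->
  exists N : nat, (0 < N)%N /\ forall p k, square p -> (k < N)%N ->
   0 < dot (F (k%:R / N%:R * p.1, k%:R / N%:R * p.2))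
           (F (k.+1%:R / N%:R * p.1, k.+1%:R / N%:R * p.2)).
Proof.
move=> cF F0.
pose I01 : set R := `[0, 1]%classic.
pose K : set ((R * R) * R) := (I01 `*` I01) `*` I01.
have cK : compact K.
  by apply: compact_setX; [apply: compact_setX|]; exact: segment_compact.
pose P (d : R) (x : (R * R) * R) :=
  0 < dot (F (x.2 * x.1.1, x.2 * x.1.2)) (F ((x.2 + d) * x.1.1, (x.2 + d) * x.1.2)).
have cP : continuous (fun z : ((R * R) * R) * R =>
  dot (F (z.1.2 * z.1.1.1, z.1.2 * z.1.1.2))
      (F ((z.1.2 + z.2) * z.1.1.1, (z.1.2 + z.2) * z.1.1.2))).
  by rewrite /dot; prove_continuous.
have : \forall d \near (0 : R), K `<=` P d.
  move/compact_near_coveringP: cK => cK.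
  apply: (cK R (nbhs (0 : R)) P) => -[[x y] u].
  rewrite /K /I01 /= !in_itv /= => -[[x01 y01] u01].
  have := cP (((x, y), u), 0).
  move=> /cvgr_gt; apply; rewrite /= addr0; apply: dot_gt0; apply: F0.
  by move: x01 y01 u01 => /andP[? ?] /andP[? ?] /andP[? ?]; split => /=;
    rewrite mulr_ge0 //= mulr_ile1.
move=> /nbhs_ballP[e /= e0 eP].
have [N Ne] : exists N : nat, (0 < N)%N && (N%:R^-1 < e).
  exists (Num.truncn e^-1).+1; rewrite /=.
  rewrite invf_plt ?posrE ?ltr0n //.
  by rewrite truncnS_gt.
case/andP: Ne => N0 Ne; exists N; split=> // p k [p1 p2] kN.
have N0' : (0 : R) < N%:R by rewrite ltr0n.
have : ball (0 : R) e N%:R^-1.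
  by rewrite /ball /= sub0r normrN gtr0_norm // invr_gt0.
move/eP => /(_ (p, k%:R / N%:R)); rewrite /P /K /I01 /= -natr1.
rewrite [k%:R / _ + _^-1](_ : _ = (k%:R + 1) / N%:R); last by rewrite mulrDl mul1r.
rewrite !in_itv /=; apply; split => //.
by rewrite divr_ge0 //= ler_pdivrMr // mul1r ler_nat ltnW.
Qed.

(** The square is star-shaped: each point is reached from the origin along a
    segment, which a fixed number of steps subdivides finely enough for
    [polar_step].  Summing the increments gives the argument by a formula that
    is visibly continuous, so that nothing has to be glued. *)
Lemma polar_lift (F : R * R -> R * R) : continuous F ->
  (forall p, square p -> F p <> (0, 0)) ->
  exists2 Phi : R * R -> R, continuous Phi & forall p, square p -> polar (F p) (Phi p).
Proof.
move=> cF F0; have [N [N0 mesh]] := lift_mesh cF F0.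
have sq0 : square (0, 0) by split; rewrite /= lexx ler01.
have [a0 pa0] := polar_exists (F0 _ sq0).
pose c (p : R * R) := (clamp p.1, clamp p.2).
have sqc p : square (c p) by split; exact: clamp_bounds.
pose G k (p : R * R) := F (k%:R / N%:R * (c p).1, k%:R / N%:R * (c p).2).
have cG k : continuous (G k).
  by rewrite /G /c /=; prove_continuous.
(* The branch i >= N, absent from Phi N, makes every summand continuous. *)
pose Phi m p := a0 + \sum_(i < m) atan (cross (G i p) (G i.+1 p) /
   (if (i < N)%N then dot (G i p) (G i.+1 p) else 1)).
have PhiP m p : (m <= N)%N -> polar (G m p) (Phi m p).
  elim: m => [_|m IH mN].
    by rewrite /Phi big_ord0 addr0 /G !mul0r.
  rewrite /Phi big_ord_recr /= addrA mN; apply: polar_step; first exact: IH (ltnW mN).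
  exact: (mesh (c p)).
exists (Phi N).
  apply: continuous_add; first by prove_continuous.
  apply: (@continuous_sumf _ _ _ (fun i p => atan (cross (G i p) (G i.+1 p) /
   (if (i < N)%N then dot (G i p) (G i.+1 p) else 1)))) => i.
  have ci := cG i; have ci1 := cG i.+1.
  apply: (@continuous_compose _ _ _ (@atan R)); last by move=> x; exact: continuous_atan.
  apply: continuous_div.
  - by rewrite /cross; prove_continuous.
  - by case: (i < N)%N; [rewrite /dot; prove_continuous | prove_continuous].
  - by move=> p; case: ifP => // iN; rewrite gt_eqF //; exact: (mesh (c p)).
move=> p [p1 p2]; have := PhiP N p (leqnn N).
rewrite /G /c /= !clamp_id // divff ?mul1r ?pnatr_eq0 -?lt0n //; last by case: (p).
Qed.

End Polar.

(** * Angles along a path, and the crossing of two paths *)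

Section Angle.
Context {R : realType}.
Implicit Types (u : R * R) (a b t : R).

Lemma cos_sin_periodz a (m : int) :
  cos (a + 2 * pi * m%:~R) = cos a /\ sin (a + 2 * pi * m%:~R) = sin a.
Proof.
have perN k b : cos (b + 2 * pi * k%:R) = cos b /\ sin (b + 2 * pi * k%:R) = sin b.
  have -> : 2 * pi * k%:R = (pi : R) *+ 2 *+ k by rewrite -mulrnA -[RHS]mulr_natr natrM; ring.
  by split; [exact: (periodicn (@cosD2pi R)) | exact: (periodicn (@sinD2pi R))].
case: m => k; first by rewrite -pmulrn; exact: perN.
have := perN k.+1 (a + 2 * pi * (Negz k)%:~R).
by rewrite NegzE mulrNz -pmulrn mulrN subrK => -[-> ->].
Qed.

Lemma cos_eq1 a : cos a = 1 -> exists m : int, a = 2 * pi * m%:~R.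
Proof.
move=> ca; have pi0 := pi_gt0 R.
have pi2 : (0 : R) < 2 * pi by lra.
pose m := Num.floor (a / (2 * pi)); exists m.
pose w := a + 2 * pi * (- m)%:~R.
have cw : cos w = 1 by rewrite /w (cos_sin_periodz a (- m)).1.
have /andP[ml mr] := floor_itv (a / (2 * pi)).
have w0 : 0 <= w.
  by rewrite /w mulrNz mulrN subr_ge0 mulrC -ler_pdivlMr.
have w1 : w < 2 * pi.
  rewrite /w mulrNz mulrN ltrBlDr -[X in X + _]mulr1 -mulrDr mulrC.
  by rewrite -ltr_pdivrMr // addrC -[1]/(1%:~R) -intrD.
suff : w = 0 by rewrite /w mulrNz mulrN => /subr0_eq.
have in0 : (0 : R) \in `[0, pi] by rewrite in_itv /= lexx ltW.
have [wp|wp] := leP w pi.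
  by apply: cos_inj; rewrite ?in_itv /= ?w0 ?wp ?lexx ?ltW // cw cos0.
have : 2 * pi - w = 0; last by lra.
apply: cos_inj => //; first by rewrite in_itv /=; lra.
rewrite cos0 addrC; have := (cos_sin_periodz (- w) 1).1.
by rewrite mulr1 cosN cw.
Qed.

Lemma angle_unique a b : cos a = cos b -> sin a = sin b ->
  exists m : int, a = b + 2 * pi * m%:~R.
Proof.
move=> c s; have [|m am] := @cos_eq1 (a - b).
  by rewrite cosB c s -!expr2 cos2Dsin2.
by exists m; rewrite -am addrC subrK.
Qed.

(** A continuous angle starting at 0 with nonnegative sine cannot leave
    [0, pi]: just outside this interval the sine is negative, and the
    intermediate value theorem forbids jumping over. *)
Lemma angle_range (f : R -> R) : continuous f -> f 0 = 0 ->
  (forall t, 0 <= t <= 1 -> 0 <= sin (f t)) -> 0 <= f 1 <= pi.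
Proof.
move=> cf f0 fs; have pi0 := pi_gt0 R.
have ivt (v : R) : Num.min 0 (f 1) <= v <= Num.max 0 (f 1) -> 0 <= sin v.
  move=> vb; have [||c] := @IVT R f 0 1 v ler01.
  - by apply: continuous_subspaceT.
  - by rewrite f0.
  by rewrite in_itv /= => c01 <-; exact: fs.
apply/andP; split; rewrite leNgt; apply/negP => f1.
  have : 0 <= sin (Num.max (f 1) (- (pi / 2))).
    apply: ivt; rewrite (min_r (ltW f1)) (max_l (ltW f1)).
    by rewrite le_max lexx /= ge_max (ltW f1) /=; lra.
  rewrite leNgt => /negP; apply; rewrite -oppr_gt0 -sinN; apply: sin_gt0_pi.
  by rewrite oppr_max lt_min opprK oppr_gt0 f1 /= gt_min; apply/andP; split; [lra|];
    apply/orP; right; lra.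
have : 0 <= sin (Num.min (f 1) (3 / 2 * pi)).
  have f10 : 0 <= f 1 by lra.
  apply: ivt; rewrite (min_l f10) (max_r f10).
  by rewrite ge_min lexx /= le_min f10 /= andbT; lra.
rewrite leNgt => /negP; apply.
set w := Num.min _ _.
have wb : pi < w < 2 * pi.
  by rewrite /w lt_min f1 gt_min /=; apply/andP; split; [lra|apply/orP; right; lra].
rewrite -(subrK pi w) sinDpi oppr_lt0; apply: sin_gt0_pi; lra.
Qed.

Lemma polar_conj u a : polar u a -> polar (u.1, - u.2) (- a).
Proof. by case=> r r0 ->; exists r => //; rewrite cosN sinN mulrN. Qed.

(** A path that stays in a closed half-plane whose boundary line contains the
    origin and both endpoints turns by 0 or by pi. *)
Lemma lift_change_ccw (F : R -> R * R) (Phi : R -> R) :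
  continuous Phi -> (forall t, 0 <= t <= 1 -> polar (F t) (Phi t)) ->
  (forall t, 0 <= t <= 1 -> 0 <= cross (F 0) (F t)) -> cross (F 0) (F 1) = 0 ->
  (0 < dot (F 0) (F 1) -> Phi 1 = Phi 0) /\
  (dot (F 0) (F 1) < 0 -> Phi 1 = Phi 0 + pi).
Proof.
move=> cPhi pF crF cr1; have pi0 := pi_gt0 R.
have t0 : 0 <= (0 : R) <= 1 by rewrite lexx ler01.
have t1 : 0 <= (1 : R) <= 1 by rewrite lexx ler01.
have [r0 r00 F0] := pF 0 t0.
have crE t r : F t = (r * cos (Phi t), r * sin (Phi t)) ->
  cross (F 0) (F t) = r0 * r * sin (Phi t - Phi 0).
  by rewrite F0 => ->; rewrite /cross sinB /=; ring.
have dotE t r : F t = (r * cos (Phi t), r * sin (Phi t)) ->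
  dot (F 0) (F t) = r0 * r * cos (Phi t - Phi 0).
  by rewrite F0 => ->; rewrite /dot cosB /=; ring.
have rng : 0 <= Phi 1 - Phi 0 <= pi.
  apply: (@angle_range (fun t => Phi t - Phi 0)); first by prove_continuous.
  - by rewrite subrr.
  - move=> t t01; have [r rp /crE E] := pF t t01.
    by have := crF t t01; rewrite E pmulr_rge0 // mulr_gt0.
have [r rp F1] := pF 1 t1; have := cr1; rewrite (crE _ _ F1) (dotE _ _ F1).
have rr : 0 < r0 * r by rewrite mulr_gt0.
move/eqP; rewrite mulf_eq0 (gt_eqF rr) /= => /eqP s0.
have c1 : (cos (Phi 1 - Phi 0) - 1) * (cos (Phi 1 - Phi 0) + 1) = 0.
  by have := cos2Dsin2 (Phi 1 - Phi 0); rewrite s0; lra.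
have inpi b : 0 <= b <= pi -> b \in `[0, pi] by rewrite in_itv.
rewrite (pmulr_rgt0 _ rr) (pmulr_rlt0 _ rr).
move/eqP: c1; rewrite mulf_eq0 => /orP[]/eqP c1; split => c2; try lra.
- suff : Phi 1 - Phi 0 = 0 by lra.
  by apply: cos_inj; [exact: inpi | apply: inpi; lra | rewrite cos0; lra].
- suff : Phi 1 - Phi 0 = pi by lra.
  by apply: cos_inj; [exact: inpi | apply: inpi; lra | rewrite cospi; lra].
Qed.

Lemma lift_change_cw (F : R -> R * R) (Phi : R -> R) :
  continuous Phi -> (forall t, 0 <= t <= 1 -> polar (F t) (Phi t)) ->
  (forall t, 0 <= t <= 1 -> cross (F 0) (F t) <= 0) -> cross (F 0) (F 1) = 0 ->
  (0 < dot (F 0) (F 1) -> Phi 1 = Phi 0) /\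
  (dot (F 0) (F 1) < 0 -> Phi 1 = Phi 0 - pi).
Proof.
move=> cPhi pF crF cr1.
pose F' t := ((F t).1, - (F t).2).
have crE t : cross (F' 0) (F' t) = - cross (F 0) (F t) by rewrite /cross /=; ring.
have dotE t : dot (F' 0) (F' t) = dot (F 0) (F t) by rewrite /dot /=; ring.
have [||||e1 e2] := @lift_change_ccw F' (fun t => - Phi t).
- by prove_continuous.
- by move=> t /pF /polar_conj.
- by move=> t /crF; rewrite crE oppr_ge0.
- by rewrite crE cr1 oppr0.
by rewrite dotE in e1 e2; split => [/e1|/e2]; lra.
Qed.

(** Two paths in a half-plane with interleaved endpoints on its boundary meet.
    The half-plane has coordinates [r <= 1] and [th], as in the universal cover
    of the punctured disk.  On each side of the square the difference of the
    paths stays in a half-plane [x >= 0] or [x <= 0], so its argument changes by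
    0 or by pi, and the two ways around the square disagree by 2pi. *)
Lemma crossing (r1 th1 r2 th2 : R -> R) :
  continuous r1 -> continuous th1 -> continuous r2 -> continuous th2 ->
  (forall t, 0 <= t <= 1 -> r1 t <= 1) -> (forall t, 0 <= t <= 1 -> r2 t <= 1) ->
  r1 0 = 1 -> r1 1 = 1 -> r2 0 = 1 -> r2 1 = 1 ->
  th1 0 < th2 0 -> th2 0 < th1 1 -> th1 1 < th2 1 ->
  exists s t, [/\ 0 <= s <= 1, 0 <= t <= 1, r1 s = r2 t & th1 s = th2 t].
Proof.
move=> cr1 ct1 cr2 ct2 r1le r2le r10 r11 r20 r21 o1 o2 o3.
apply: contrapT => nex.
pose F (p : R * R) := (r1 p.1 - r2 p.2, th1 p.1 - th2 p.2).
have cF : continuous F by rewrite /F; prove_continuous.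
have t0 : 0 <= (0 : R) <= 1 by rewrite lexx ler01.
have t1 : 0 <= (1 : R) <= 1 by rewrite lexx ler01.
have F0 p : square p -> F p <> (0, 0).
  move=> [p1 p2] [] /subr0_eq e1 /subr0_eq e2; apply: nex.
  by exists p.1, p.2.
have [Phi cPhi pPhi] := polar_lift cF F0.
have pi0 := pi_gt0 R.
have cP0 (t : R) : continuous (fun s : R => Phi (s, t)) by prove_continuous.
have cP1 (s : R) : continuous (fun t : R => Phi (s, t)) by prove_continuous.
(* Sides of the square, in terms of the first coordinate r1 s - r2 t:
   nonnegative where r1 = 1, nonpositive where r2 = 1. *)
have [||| e1 _] := lift_change_ccw (cP1 0) (F := fun t => F (0, t)).
- by move=> t t01; apply: pPhi.
- move=> t t01; rewrite /cross /F /= r10 r20 subrr mul0r sub0r -mulNr.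
  by rewrite mulr_ge0 ?subr_ge0 ?r2le // oppr_ge0 subr_le0 ltW.
- by rewrite /cross /F /= r10 r20 r21; ring.
have [||| e2 _] := lift_change_cw (cP0 1) (F := fun s => F (s, 1)).
- by move=> t t01; apply: pPhi.
- move=> t t01; rewrite /cross /F /= r10 r21 subrr mul0r sub0r -mulrN.
  by rewrite mulr_le0_ge0 ?oppr_ge0 ?subr_le0 ?r1le //; lra.
- by rewrite /cross /F /= r10 r11 r21; ring.
have [||| _ e3] := lift_change_cw (cP0 0) (F := fun s => F (s, 0)).
- by move=> t t01; apply: pPhi.
- move=> t t01; rewrite /cross /F /= r10 r20 subrr mul0r sub0r -mulrN.
  by rewrite mulr_le0_ge0 ?oppr_ge0 ?subr_le0 ?r1le //; lra.
- by rewrite /cross /F /= r10 r11 r20; ring.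
have [||| _ e4] := lift_change_cw (cP1 1) (F := fun t => F (1, t)).
- by move=> t t01; apply: pPhi.
- move=> t t01; rewrite /cross /F /= r11 r20 subrr mul0r sub0r oppr_le0.
  by rewrite mulr_ge0 ?subr_ge0 ?r2le // ltW.
- by rewrite /cross /F /= r11 r20 r21; ring.
move: e1 e2 e3 e4; rewrite /dot /F /= r10 r11 r20 r21 !subrr !mul0r !add0r.
move=> e1 e2 e3 e4.
have E1 : Phi (0, 1) = Phi (0, 0) by apply: e1; rewrite nmulr_rgt0 ?subr_lt0 //; lra.
have E2 : Phi (1, 1) = Phi (0, 1) by apply: e2; rewrite nmulr_rgt0 ?subr_lt0 //; lra.
have E3 : Phi (1, 0) = Phi (0, 0) - pi by apply: e3; rewrite nmulr_rlt0 ?subr_gt0 ?subr_lt0.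
have E4 : Phi (1, 1) = Phi (1, 0) - pi by apply: e4; rewrite pmulr_rlt0 ?subr_gt0 ?subr_lt0.
by lra.
Qed.

End Angle.

(** * Euclidean norm and uniqueness of arguments *)

Section PolarMore.
Context {R : realType}.
Implicit Types (p q : R * R) (a b t : R).

Definition enorm p : R := Num.sqrt (p.1 ^+ 2 + p.2 ^+ 2).

Lemma enorm_pol r a : 0 <= r -> enorm (r * cos a, r * sin a) = r.
Proof.
move=> r0; rewrite /enorm /= !exprMn -mulrDr cos2Dsin2 mulr1.
by rewrite sqrtr_sqr ger0_norm.
Qed.

Lemma polar_enorm p a : polar p a ->
  0 < enorm p /\ p = (enorm p * cos a, enorm p * sin a).
Proof. by case=> r r0 ->; rewrite enorm_pol ?ltW. Qed.

Lemma continuous_enorm : continuous (@enorm).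
Proof.
rewrite /enorm; apply: (@continuous_compose _ _ _ (@Num.sqrt R)).
  by rewrite /GRing.exp /=; prove_continuous.
exact: sqrt_continuous.
Qed.

Lemma polar_neq0 p a : polar p a -> p <> (0, 0).
Proof.
by case=> r r0 -> [c s]; have := @enorm_pol r a (ltW r0);
  rewrite c s /enorm /= expr0n addr0 sqrtr0 => E; rewrite -E ltxx in r0.
Qed.

Lemma polar_circle_point a : polar (circle_point a) a.
Proof. by exists 1; rewrite // !mul1r. Qed.

Lemma enorm_circle_point a : enorm (circle_point a) = 1.
Proof. by rewrite -(@enorm_pol 1 a) // !mul1r. Qed.

Lemma enorm0 : enorm (0, 0) = 0.
Proof. by rewrite /enorm /= expr0n addr0 sqrtr0. Qed.

Lemma enorm_ge0 p : 0 <= enorm p.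
Proof. exact: sqrtr_ge0. Qed.

Lemma enorm_sqr p : enorm p ^+ 2 = p.1 ^+ 2 + p.2 ^+ 2.
Proof. by rewrite sqr_sqrtr // addr_ge0 ?sqr_ge0. Qed.

Lemma enorm_gt0 p : p <> (0, 0) -> 0 < enorm p.
Proof. by case/polar_exists=> a /polar_enorm[]. Qed.

Lemma enormZ p c : 0 <= c -> enorm (c * p.1, c * p.2) = c * enorm p.
Proof.
by move=> c0; rewrite /enorm /= !exprMn -mulrDr sqrtrM ?sqr_ge0 // sqrtr_sqr ger0_norm.
Qed.

Lemma disk_enorm p : disk p <-> enorm p <= 1.
Proof.
rewrite /disk /= -enorm_sqr; split => [|h]; last by rewrite exprn_ile1 ?enorm_ge0.
by rewrite -[X in _ <= X](expr1n _ 2) ler_sqr ?nnegrE ?enorm_ge0.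
Qed.

Lemma circle_enorm p : circle p <-> enorm p = 1.
Proof.
rewrite /circle /= -enorm_sqr; split => [|->]; last by rewrite expr1n.
by move/eqP; rewrite sqrf_eq1 => /orP[]/eqP // e; have := enorm_ge0 p; rewrite e; lra.
Qed.

Lemma polar_same p a b : polar p a -> polar p b ->
  cos a = cos b /\ sin a = sin b.
Proof.
move=> /polar_enorm[r0 pa] /polar_enorm[_]; rewrite {1}pa.
have r0' : enorm p != 0 by rewrite gt_eqF.
by case=> /(mulfI r0') -> /(mulfI r0') ->.
Qed.

(** Two arguments of one point differ by a period, by which an argument of
    another point can be changed. *)
Lemma polar_shift p q a b c : polar p a -> polar p b -> polar q c ->
  polar q (c + (a - b)).
Proof.
move=> pa pb [r r0 ->]; have [ca sa] := polar_same pa pb.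
have c1 : cos (a - b) = 1 by rewrite cosB ca sa -!expr2 cos2Dsin2.
have s0 : sin (a - b) = 0 by rewrite sinB ca sa mulrC subrr.
by exists r; rewrite // cosD (sinD c) c1 s0 !mulr1 !mulr0 subr0 addr0.
Qed.

Lemma polar_lift_const p (Phi : R -> R) : continuous Phi ->
  (forall t, 0 <= t <= 1 -> polar p (Phi t)) -> Phi 1 = Phi 0.
Proof.
move=> cPhi pP.
have cr : cross p p = 0 by rewrite /cross mulrC subrr.
have [|//|e _] := lift_change_ccw cPhi pP; first by rewrite cr.
apply: e; apply: dot_gt0; apply: polar_neq0 (pP 0 _); lra.
Qed.

(** The total turning does not depend on the choice of the argument. *)
Lemma polar_lift_unique (g : R -> R * R) (th th' : R -> R) :
  continuous th -> continuous th' ->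
  (forall t, 0 <= t <= 1 -> polar (g t) (th t)) ->
  (forall t, 0 <= t <= 1 -> polar (g t) (th' t)) ->
  th 1 - th 0 = th' 1 - th' 0.
Proof.
move=> ct ct' p p'.
suff : th 1 - th' 1 = th 0 - th' 0 by lra.
apply: (@polar_lift_const (1, 0) (fun t => th t - th' t)); first by prove_continuous.
move=> t t01; rewrite -[_ - _]add0r; apply: polar_shift (p t t01) (p' t t01) _.
by exists 1; rewrite // cos0 sin0 mulr1 mulr0.
Qed.

End PolarMore.

(** * Winding of arcs between boundary vertices *)

Lemma residue (n : nat) (n0 : (0 < n)%N) (i : int) :
  exists2 k : nat, (1 <= k <= n)%N & exists m : int, i = k%:Z + n%:Z * m.
Proof.
(* The shift by 1 moves the residues 0, ..., n - 1 to 1, ..., n. *)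
have nZ : n%:Z != 0 by lia.
have r0 := modz_ge0 (i - 1) nZ.
have r1 := ltz_pmod (i - 1) (_ : 0 < n%:Z).
exists (`|((i - 1) %% n%:Z)%Z|.+1)%N; first by have := r1 ltac:(lia); lia.
exists ((i - 1) %/ n%:Z)%Z; have := divz_eq (i - 1) n%:Z.
by lia.
Qed.

Section Crown.
Context {R : realType}.
Variable n : nat.
Hypothesis n0 : (0 < n)%N.
Implicit Types (g d : R -> R * R) (i j k l m : int) (p : R * R) (s t : R).

Definition root_angle i : R := 2 * pi * i%:~R / n%:R.
Definition rootv i : R * R := circle_point (root_angle i).

Let n0R : (0 : R) < n%:R. Proof. by rewrite ltr0n. Qed.

Lemma root_angle_lt i j : (root_angle i < root_angle j) = (i < j).
Proof.
rewrite /root_angle ltr_pM2r ?invr_gt0 // ltr_pM2l ?ltr_int //.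
by have := pi_gt0 R; lra.
Qed.

Lemma root_angleD i m : root_angle (i + n%:Z * m) = root_angle i + 2 * pi * m%:~R.
Proof.
by rewrite /root_angle intrD intrM -pmulrn; field; rewrite gt_eqF.
Qed.

Lemma root_angle_mod i a : cos a = cos (root_angle i) -> sin a = sin (root_angle i) ->
  exists m, a = root_angle (i + n%:Z * m).
Proof. by move=> c s; have [m ->] := angle_unique c s; exists m; rewrite root_angleD. Qed.

Lemma rootv_mod i m : rootv (i + n%:Z * m) = rootv i.
Proof.
rewrite /rootv root_angleD /circle_point.
by have [-> ->] := cos_sin_periodz (root_angle i) m.
Qed.

Lemma boundary_vertexE (k : nat) : boundary_vertex n k = rootv k%:Z.
Proof. by rewrite /boundary_vertex /rootv /root_angle -pmulrn. Qed.

Lemma vertexP p : vertex n p <-> p = (0, 0) \/ exists i, p = rootv i.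
Proof.
split=> -[]; [by left| |by left|].
  by move=> [k _ ->]; right; exists k%:Z; rewrite boundary_vertexE.
move=> [i ->]; right; have [k kn [m ->]] := residue n0 i.
by exists k => //; rewrite rootv_mod boundary_vertexE.
Qed.

Lemma enorm_rootv i : enorm (rootv i) = 1.
Proof. exact: enorm_circle_point. Qed.

Lemma not_vertex p : 0 < enorm p < 1 -> ~ vertex n p.
Proof.
move=> pp /vertexP[p0|[i pi]]; first by rewrite p0 enorm0 ltxx in pp.
by rewrite pi enorm_rootv ltxx andbF in pp.
Qed.

Lemma rootv_inj i j : (1 <= i <= n%:Z) -> (1 <= j <= n%:Z) -> rootv i = rootv j -> i = j.
Proof.
move=> i1 j1 [c s]; have [m] := root_angle_mod c s.
move=> e; suff ij : i = j + n%:Z * m.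
  have [m0|[m0|m0]] : m = 0 \/ m <= -1 \/ 1 <= m by lia.
  - by rewrite ij m0; lia.
  - have : n%:Z * m <= - n%:Z by nia.
    lia.
  - have : n%:Z <= n%:Z * m by nia.
    lia.
have := root_angle_lt i (j + n%:Z * m); have := root_angle_lt (j + n%:Z * m) i.
by rewrite e ltxx; lia.
Qed.

Lemma arc_interior g t : simple_arc n g -> 0 < t < 1 -> 0 < enorm (g t) < 1.
Proof.
case=> _ _ /(_ t) gi _ t01; have [|/disk_enorm dg [cg vg]] := gi.
  by rewrite in_itv.
apply/andP; split.
  by apply: enorm_gt0 => g0; apply: vg; left.
rewrite lt_neqAle dg andbT.
by apply/eqP => /circle_enorm.
Qed.

Lemma itv01_cases t : 0 <= t <= 1 -> [\/ t = 0, t = 1 | 0 < t < 1].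
Proof.
case/andP; rewrite le_eqVlt => /predU1P[<- _|t0]; first by constructor 1.
rewrite le_eqVlt => /predU1P[->|t1]; first by constructor 2.
by constructor 3; rewrite t0.
Qed.

Lemma vertex_enorm p : vertex n p -> enorm p <= 1.
Proof. by case/vertexP=> [->|[i ->]]; rewrite ?enorm0 ?enorm_rootv. Qed.

Lemma arc_enorm g t : simple_arc n g -> 0 <= t <= 1 -> enorm (g t) <= 1.
Proof.
move=> sg /itv01_cases[->|->|/(arc_interior sg)/andP[_ /ltW] //];
  by case: sg => _ [v0 v1] _ _; exact: vertex_enorm.
Qed.

Lemma arc_neq0 g t : simple_arc n g -> g 0 <> (0, 0) -> g 1 <> (0, 0) ->
  0 <= t <= 1 -> g t <> (0, 0).
Proof.
move=> sg g0 g1 /itv01_cases[->|->|/(arc_interior sg)] //.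
by move=> + gt; rewrite gt enorm0 ltxx.
Qed.

Lemma simple_arc_continuous g : simple_arc n g ->
  continuous (fun t => g (clamp t)).
Proof. by case=> cg _ _ _; exact: continuous_clamp_path. Qed.

Lemma rootv_neq0 i : rootv i <> (0, 0).
Proof. by move=> e; have := enorm_rootv i; rewrite e enorm0; lra. Qed.

(** The arc turns from the argument of vertex [i] to that of vertex [i + k] in
    the universal cover.  Indices are integers, to be read modulo n where only
    vertices are concerned. *)
Definition winding g i k := exists th : R -> R,
  [/\ continuous th, forall t, 0 <= t <= 1 -> polar (g t) (th t),
      th 0 = root_angle i & th 1 = root_angle (i + k)].

Let I0 : 0 <= (0 : R) <= 1. Proof. by rewrite lexx ler01. Qed.
Let I1 : 0 <= (1 : R) <= 1. Proof. by rewrite lexx ler01. Qed.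

Lemma winding_exists g i j : simple_arc n g -> g 0 = rootv i -> g 1 = rootv j ->
  exists k, winding g i k.
Proof.
move=> sg g0 g1.
have [||Phi cP pP] := @polar_lift _ (fun p => g (clamp p.2)).
- have := simple_arc_continuous sg => cg.
  exact: (@continuous_compose _ _ _ (fun t => g (clamp t)) snd) (continuous_sndf continuous_idf) cg.
- move=> p [_ p2]; rewrite clamp_id //.
  by apply: arc_neq0 sg _ _ p2; rewrite ?g0 ?g1; exact: rootv_neq0.
have pt t : 0 <= t <= 1 -> polar (g t) (Phi (0, t)).
  by move=> t01; have := pP (0, t); rewrite /= clamp_id //; apply.
have p0 : polar (g 0) (root_angle i) by rewrite g0; exact: polar_circle_point.
have p1 : polar (g 1) (root_angle j) by rewrite g1; exact: polar_circle_point.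
pose th t := Phi (0, t) + (root_angle i - Phi (0, 0)).
have pth t : 0 <= t <= 1 -> polar (g t) (th t).
  by move=> t01; exact: polar_shift p0 (pt 0 I0) (pt t t01).
have [c s] := polar_same (pth 1 I1) p1.
have [m th1] := root_angle_mod c s.
exists (j + n%:Z * m - i), th; split => //.
- by rewrite /th; prove_continuous.
- by rewrite /th addrC subrK.
- by rewrite th1; congr root_angle; lia.
Qed.

Lemma winding_start g i k : simple_arc n g -> winding g i k -> g 0 = rootv i.
Proof.
move=> sg [th [_ pth th0 _]]; have := pth 0 I0; rewrite th0 => pg.
have [e0 e] := polar_enorm pg.
case: sg => _ [/vertexP[g0|[j gj]] _] _ _; first by rewrite g0 enorm0 ltxx in e0.
by rewrite e gj enorm_rootv !mul1r.
Qed.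

Lemma winding_end g i k : simple_arc n g -> winding g i k -> g 1 = rootv (i + k).
Proof.
move=> sg [th [_ pth _ th1]]; have := pth 1 I1; rewrite th1 => pg.
have [e0 e] := polar_enorm pg.
case: sg => _ [_ /vertexP[g1|[j gj]]] _ _; first by rewrite g1 enorm0 ltxx in e0.
by rewrite e gj enorm_rootv !mul1r.
Qed.

Lemma winding_mod g i k m : winding g i k -> winding g (i + n%:Z * m) k.
Proof.
move=> [th [ct pth th0 th1]]; exists (fun t => th t + 2 * pi * m%:~R); split.
- by prove_continuous.
- move=> t /pth [r r0 ->]; exists r => //.
  by have [-> ->] := cos_sin_periodz (th t) m.
- by rewrite th0 root_angleD.
- by rewrite th1 -root_angleD; congr root_angle; lia.
Qed.

Lemma winding_reverse g i k : winding g i k -> winding (reverse g) (i + k) (- k).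
Proof.
move=> [th [ct pth th0 th1]]; exists (fun t => th (1 - t)); split.
- by prove_continuous.
- by move=> t t01; apply: pth; lra.
- by rewrite subr0.
- by rewrite subrr th0; congr root_angle; lia.
Qed.

Lemma reverseK g : reverse (reverse g) = g.
Proof. by apply/funext => t; rewrite /reverse; congr g; lra. Qed.

(** The argument lifts over the square of a homotopy, and it is constant along
    the two sides where the endpoints are fixed. *)
Lemma winding_homotopic g d i k : simple_arc n g -> simple_arc n d ->
  winding g i k -> homotopic n g d -> winding d i k.
Proof.
move=> sg sd wg [H [cH _ Hgd Hend Hv]].
have g0 := winding_start sg wg; have g1 := winding_end sg wg.
have in01 t : 0 <= t <= 1 -> t \in `[0, 1] by rewrite in_itv.
have Hg t : 0 <= t <= 1 -> H (0, t) = g t by move=> /in01/Hgd[].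
have Hd t : 0 <= t <= 1 -> H (1, t) = d t by move=> /in01/Hgd[].
have H0 s : 0 <= s <= 1 -> H (s, 0) = g 0 by move=> /in01/Hend[].
have H1 s : 0 <= s <= 1 -> H (s, 1) = g 1 by move=> /in01/Hend[].
have d0 : d 0 = g 0 by rewrite -Hd ?H0.
have d1 : d 1 = g 1 by rewrite -Hd ?H1.
pose F p := H (clamp p.1, clamp p.2).
have cF : continuous F.
  apply: (within_compose (h := fun p => (clamp p.1, clamp p.2)) cH).
    by prove_continuous.
  by move=> p; split => /=; rewrite in_itv /= clamp_bounds.
have FE s t : 0 <= s <= 1 -> 0 <= t <= 1 -> F (s, t) = H (s, t).
  by move=> s01 t01; rewrite /F /= !clamp_id.
have F0 p : square p -> F p <> (0, 0).
  case: p => s t [/= s01 t01]; rewrite FE //.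
  have gn u := @arc_neq0 g u sg; have dn u := @arc_neq0 d u sd.
  rewrite d0 d1 g0 g1 in dn; rewrite g0 g1 in gn.
  have rn := rootv_neq0.
  move: (s01) => /itv01_cases[->|->|s01'].
  - by rewrite Hg //; exact: gn.
  - by rewrite Hd //; exact: dn.
  move: (t01) => /itv01_cases[->|->|t01'].
  - by rewrite H0 // g0.
  - by rewrite H1 // g1.
  by move=> e; apply: (Hv s t); rewrite ?in_itv //= e; left.
have [Phi cP pP] := polar_lift cF F0.
have pPE s t : 0 <= s <= 1 -> 0 <= t <= 1 -> polar (H (s, t)) (Phi (s, t)).
  by move=> s01 t01; rewrite -FE //; exact: pP.
case: wg => th [ct pth th0 th1].
have cPs (t : R) : continuous (fun s : R => Phi (s, t)) by prove_continuous.
have cPt (s : R) : continuous (fun t : R => Phi (s, t)) by prove_continuous.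
have e0 : Phi (1, 0) = Phi (0, 0).
  by apply: (polar_lift_const (cPs 0) (p := g 0)) => s s01; rewrite -(H0 s) //; exact: pPE.
have e1 : Phi (1, 1) = Phi (0, 1).
  by apply: (polar_lift_const (cPs 1) (p := g 1)) => s s01; rewrite -(H1 s) //; exact: pPE.
have pg t : 0 <= t <= 1 -> polar (g t) (Phi (0, t)).
  by move=> t01; rewrite -Hg //; exact: pPE.
have e := polar_lift_unique ct (cPt 0) pth pg.
exists (fun t => Phi (1, t) + (th 0 - Phi (0, 0))); split.
- by prove_continuous.
- move=> t t01; apply: polar_shift (pth 0 I0) (pg 0 I0) _.
  by rewrite -Hd //; exact: pPE.
- by rewrite e0 -th0; lra.
- by rewrite e1 -th1; lra.
Qed.

(** Linear interpolation of modulus and argument.  At intermediate times the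
    modulus is strictly between 0 and 1 because that of the simple arc [g] is;
    of [d] only a bound by 1 is required, which admits constant paths at a
    boundary vertex. *)
Lemma polar_homotopic g d (th th' : R -> R) :
  simple_arc n g -> continuous (fun t => d (clamp t)) ->
  (forall t, 0 <= t <= 1 -> enorm (d t) <= 1) ->
  continuous th -> continuous th' ->
  (forall t, 0 <= t <= 1 -> polar (g t) (th t)) ->
  (forall t, 0 <= t <= 1 -> polar (d t) (th' t)) ->
  th 0 = th' 0 -> th 1 = th' 1 -> enorm (d 0) = enorm (g 0) ->
  enorm (d 1) = enorm (g 1) -> homotopic n g d.
Proof.
move=> sg cd d1 ct ct' pth pth' e0 e1 n00 n1.
have cg := simple_arc_continuous sg.
pose r (p : R * R) := (1 - p.1) * enorm (g (clamp p.2)) + p.1 * enorm (d (clamp p.2)).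
pose a (p : R * R) := (1 - p.1) * th p.2 + p.1 * th' p.2.
have cr : continuous r.
  have ceg : continuous (fun t => enorm (g (clamp t))).
    exact: (continuous_compose cg continuous_enorm).
  have ced : continuous (fun t => enorm (d (clamp t))).
    exact: (continuous_compose cd continuous_enorm).
  have c1 : continuous (fun p : R * R => enorm (g (clamp p.2))).
    exact: continuous_compose (continuous_sndf continuous_idf) ceg.
  have c2 : continuous (fun p : R * R => enorm (d (clamp p.2))).
    exact: continuous_compose (continuous_sndf continuous_idf) ced.
  by rewrite /r; prove_continuous.
have ca : continuous a by rewrite /a; prove_continuous.
have rE s t : 0 <= t <= 1 -> r (s, t) = (1 - s) * enorm (g t) + s * enorm (d t).
  by move=> t01; rewrite /r /= clamp_id.
have r0 s t : 0 <= s <= 1 -> 0 <= t <= 1 -> 0 < r (s, t).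
  move=> s01 t01; rewrite rE //.
  have [eg _] := polar_enorm (pth t t01); have [ed _] := polar_enorm (pth' t t01).
  by nra.
have r1 s t : 0 <= s <= 1 -> 0 <= t <= 1 -> r (s, t) <= 1.
  move=> s01 t01; rewrite rE //; have := d1 t t01; have := arc_enorm sg t01.
  by nra.
exists (fun p => (r p * cos (a p), r p * sin (a p))); split.
- by apply: continuous_subspaceT; prove_continuous.
- move=> s t; rewrite !in_itv /= => s01 t01; apply/disk_enorm.
  by rewrite enorm_pol ?r1 // ltW // r0.
- move=> t; rewrite in_itv /= => t01; rewrite /a !rE //= !subrr !subr0 !mul0r !mul1r !addr0 !add0r.
  by have [_ {3}->] := polar_enorm (pth t t01); have [_ {3}->] := polar_enorm (pth' t t01).
- move=> s; rewrite in_itv /= => s01; rewrite !rE // /a /= -e0 -e1 n00 n1 -!mulrDl !subrK !mul1r.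
  by have [_ {3}->] := polar_enorm (pth 0 I0); have [_ {3}->] := polar_enorm (pth 1 I1).
- move=> s t; rewrite !in_itv /= => s01 t01; apply: not_vertex.
  have s01' : 0 <= s <= 1 by lra.
  have t01' : 0 <= t <= 1 by lra.
  rewrite enorm_pol ?ltW ?r0 // rE //=.
  have := arc_interior sg t01; have := d1 t t01'; nra.
Qed.

(** * Orientation reversal and disjointness *)

Lemma reverse_simple g : simple_arc n g -> simple_arc n (reverse g).
Proof.
move=> sg; have cg := simple_arc_continuous sg; case: sg => _ [v0 v1] gi ginj; split.
- apply: (@continuous_within_eq _ _ _ _ (fun t => g (clamp (1 - t)))).
    apply: (@continuous_compose _ _ _ (fun t => g (clamp t)) (fun t => 1 - t)) => //.
    by prove_continuous.
  by move=> t /=; rewrite in_itv /= => t01; rewrite /reverse clamp_id //; lra.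
- by rewrite /reverse subr0 subrr.
- by move=> t; rewrite in_itv /= => t01; apply: gi; rewrite in_itv /=; lra.
- move=> s t; rewrite !in_itv /= => s01 t01 st e.
  have [|||e1 e2] := ginj (1 - t) (1 - s) _ _ _ (esym e); rewrite ?in_itv /=; try lra.
Qed.

Lemma homotopic_reverse g d : homotopic n g d -> homotopic n (reverse g) (reverse d).
Proof.
case=> H [cH dH Hgd Hend Hv]; exists (fun p => H (p.1, 1 - p.2)); split.
- apply: (@continuous_within_eq _ _ _ _ (fun p => H (clamp p.1, clamp (1 - p.2)))).
    apply: (within_compose (h := fun p : R * R => (clamp p.1, clamp (1 - p.2))) cH).
      by prove_continuous.
    by move=> p; split => /=; rewrite in_itv /= clamp_bounds.
  move=> [s t] [/=]; rewrite !in_itv /= => s01 t01; rewrite !clamp_id //; lra.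
- by move=> s t s01; rewrite in_itv /= => t01; apply: dH => //; rewrite in_itv /=; lra.
- by move=> t; rewrite in_itv /= => t01; apply: Hgd; rewrite in_itv /=; lra.
- move=> s s01; rewrite /reverse /= subr0 subrr.
  by have [-> ->] := Hend s s01.
- by move=> s t s01; rewrite in_itv /= => t01; apply: Hv => //; rewrite in_itv /=; lra.
Qed.

Lemma arc_class_reverse g : arc_class n (reverse g) = arc_class n g.
Proof.
apply/seteqP; split => d [sd h]; split => //; case: h => /homotopic_reverse;
  rewrite ?reverseK => h; by [right | left].
Qed.

Lemma disjoint_arcs_reverse g d : disjoint_arcs g d -> disjoint_arcs (reverse g) d.
Proof.
move=> gd s t; rewrite in_itv /= => s01 t01 e.
have [|s' t'] := gd (1 - s) t _ t01 e; first by rewrite in_itv /=; lra.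
by split => //; case: s' => s'; [right | left]; lra.
Qed.

Lemma disjoint_arcs_sym g d : disjoint_arcs g d -> disjoint_arcs d g.
Proof. by move=> gd s t s01 t01 e; have [] := gd t s t01 s01 (esym e). Qed.

Lemma disjoint_classes_sym (c1 c2 : set (R -> R * R)) :
  disjoint_classes c1 c2 -> disjoint_classes c2 c1.
Proof.
by case=> g [d [cg cd gd]]; exists d, g; split => //; exact: disjoint_arcs_sym.
Qed.

(** * Crossing of simple arcs *)

(** Crossing in the universal cover, pushed down to the disk.  The equality of
    the angles is kept, as it distinguishes a crossing from a common
    endpoint. *)
Lemma lifts_cross g d (th th' : R -> R) :
  simple_arc n g -> simple_arc n d -> continuous th -> continuous th' ->
  (forall t, 0 <= t <= 1 -> polar (g t) (th t)) ->
  (forall t, 0 <= t <= 1 -> polar (d t) (th' t)) ->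
  enorm (g 0) = 1 -> enorm (g 1) = 1 -> enorm (d 0) = 1 -> enorm (d 1) = 1 ->
  th 0 < th' 0 -> th' 0 < th 1 -> th 1 < th' 1 ->
  exists s t, [/\ s \in `[0, 1], t \in `[0, 1], g s = d t & th s = th' t].
Proof.
move=> sg sd ct ct' pth pth' gs ge ds de o1 o2 o3.
have cont f : simple_arc n f -> continuous (fun t => enorm (f (clamp t))).
  by move=> /simple_arc_continuous cf; exact: (continuous_compose cf continuous_enorm).
have bnd f t : simple_arc n f -> 0 <= t <= 1 -> enorm (f (clamp t)) <= 1.
  by move=> sf t01; rewrite clamp_id //; exact: arc_enorm.
have := crossing (cont _ sg) ct (cont _ sd) ct'.
rewrite !clamp_id // gs ge ds de.
case=> //; try by move=> t t01; exact: bnd.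
move=> s [t [s01 t01]]; rewrite !clamp_id // => en an.
exists s, t; rewrite !in_itv; split => //.
have [_ ->] := polar_enorm (pth s s01); have [_ ->] := polar_enorm (pth' t t01).
by rewrite en an.
Qed.

(** An arc that winds more than once around the centre meets its own translate
    by a full turn. *)
Lemma winding_le g i k : simple_arc n g -> winding g i k -> k <= n%:Z.
Proof.
move=> sg wg; rewrite leNgt; apply/negP => kn.
have gs := winding_start sg wg; have ge := winding_end sg wg.
have gs1 : enorm (g 0) = 1 by rewrite gs enorm_rootv.
have ge1 : enorm (g 1) = 1 by rewrite ge enorm_rootv.
case: wg => th [ct pth th0 th1].
have pi0 := pi_gt0 R.
have th'0 : root_angle (i + n%:Z) = th 0 + 2 * pi.
  by rewrite -[n%:Z]mulr1 root_angleD th0 mulr1.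
(* This is where k > n enters: the start of the translate comes before the end
   of the arc. *)
have lt12 : th 0 + 2 * pi < th 1.
  by rewrite -th'0 th1 root_angle_lt; lia.
have pth' t : 0 <= t <= 1 -> polar (g t) (th t + 2 * pi).
  move=> /pth [r r0 ->]; exists r => //.
  by have := cos_sin_periodz (th t) 1; rewrite mulr1 => -[-> ->].
have ct' : continuous (fun t => th t + 2 * pi) by prove_continuous.
have [||| s [t [s01 t01 e an]]] := lifts_cross sg sg ct ct' pth pth' gs1 ge1 gs1 ge1;
  try by rewrite /=; lra.
rewrite /= in an; case: sg => _ _ _ inj.
have an' : th s = th t + 2 * pi := an.
have [st|ts|st] := ltgtP s t.
- have [s0 t1] := inj s t s01 t01 st e; rewrite s0 t1 in an'.
  by clear -an' lt12 pi0; lra.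
- have [t0 s1] := inj t s t01 s01 ts (esym e); rewrite t0 s1 in an'.
  by clear -an' lt12 pi0; lra.
- by rewrite st in an'; clear -an' pi0; lra.
Qed.

(** If [i] were strictly inside the span of [d], the longer arc [g] would end
    beyond the end of [d], so the endpoints would interleave. *)
Lemma windings_nest g d i k j l : simple_arc n g -> simple_arc n d ->
  winding g i k -> winding d j l -> disjoint_arcs g d -> l <= k ->
  ~ (j < i < j + l).
Proof.
move=> sg sd wg wd gd lk /andP[ji ijl].
have en f i' k' : simple_arc n f -> winding f i' k' -> enorm (f 0) = 1 /\ enorm (f 1) = 1.
  by move=> sf wf; rewrite (winding_start sf wf) (winding_end sf wf) !enorm_rootv.
have [g0 g1] := en _ _ _ sg wg; have [d0 d1] := en _ _ _ sd wd.
case: wg => th [ct pth th0 th1]; case: wd => th' [ct' pth' th'0 th'1].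
have o1 : th' 0 < th 0 by rewrite th0 th'0 root_angle_lt.
have o2 : th 0 < th' 1 by rewrite th0 th'1 root_angle_lt.
have o3 : th' 1 < th 1 by rewrite th1 th'1 root_angle_lt; lia.
have [s [t [s01 t01 e an]]] := lifts_cross sd sg ct' ct pth' pth d0 d1 g0 g1 o1 o2 o3.
have [tE sE] := gd t s t01 s01 (esym e).
by move: an; case: tE => ->; case: sE => ->; clear -o1 o2 o3; lra.
Qed.

(** * Arcs from the centre to the boundary *)

(** At time [s] the arc follows [g] from parameter [s] on, and before that the
    segment from the centre to [g s]: this is a homotopy from [g] to the
    segment ending at [g 1].  It requires no argument of [g], which would be
    defined only away from the centre. *)
Definition shrink g p : R * R :=
  let m := Num.max (clamp p.1) (clamp p.2) in
  (clamp p.2 / m * (g (clamp m)).1, clamp p.2 / m * (g (clamp m)).2).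

(** The quotient is at most 1, so the only delicate point (0, 0) is handled by
    [g] tending to the centre there. *)
Lemma continuous_shrink g : continuous (fun t => g (clamp t)) -> g 0 = (0, 0) ->
  continuous (shrink g).
Proof.
move=> cg g0.
pose m p : R := Num.max (clamp p.1) (clamp p.2).
have cm : continuous m by rewrite /m; prove_continuous.
have cgm : continuous (fun p => g (clamp (m p))).
  exact: (@continuous_compose _ _ _ (fun t => g (clamp t)) m).
have m0 p : 0 <= clamp p.2 <= m p.
  have /andP[c0 _] := clamp_bounds p.2.
  by rewrite c0 /m le_max lexx orbT.
have coord (f : R * R -> R) : continuous f -> (forall p, m p = 0 -> f p = 0) ->
    continuous (fun p => clamp p.2 / m p * f p).
  move=> cf f0 p; have [mp|mp] := eqVneq (m p) 0; last first.
    apply: cvgM; last exact: cf.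
    have cc : continuous (fun p : R * R => clamp p.2) by prove_continuous.
    apply: cvgM; first exact: cc.
    by apply: cvgV => //; exact: cm.
  have fp := f0 p mp.
  suff : (fun q => clamp q.2 / m q * f q) @ p --> (0 : R).
    by rewrite /prop_for /continuous_at /= fp mulr0.
  apply: (@norm_cvg0 _ R).
  apply: (@squeeze_cvgr _ _ _ _ (cst 0) (fun q => `|f q|)).
  - near=> q; rewrite /= normr_ge0 /= normrM ler_piMl //.
    have /andP[c0 cmq] := m0 q.
    have [mq|mq] := eqVneq (m q) 0; first by rewrite mq invr0 mulr0 normr0.
    have mq0 : 0 < m q by rewrite lt_neqAle eq_sym mq (le_trans c0).
    have q0 : 0 <= clamp q.2 / m q by rewrite divr_ge0 // ltW.
    by rewrite ger0_norm // ler_pdivrMr // mul1r.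
  - exact: cvg_cst.
  - by rewrite -[X in _ --> X](@normr0 _ R) -fp; apply: cvg_norm; exact: cf.
have c0 : clamp (0 : R) = 0 by rewrite clamp_id.
apply: continuous_mk_pair; apply: coord; try by prove_continuous.
- by move=> p mp; rewrite /= -/(m p) mp c0 g0.
- by move=> p mp; rewrite /= -/(m p) mp c0 g0.
Unshelve. all: by end_near.
Qed.

Lemma shrinkE g s t : 0 <= s <= 1 -> 0 <= t <= 1 ->
  shrink g (s, t) = (t / Num.max s t * (g (Num.max s t)).1,
                     t / Num.max s t * (g (Num.max s t)).2).
Proof.
move=> s01 t01; rewrite /shrink /= !clamp_id //.
by rewrite le_max ge_max; lra.
Qed.

Lemma enorm_shrink g s t : 0 <= s <= 1 -> 0 <= t <= 1 ->
  enorm (shrink g (s, t)) = t / Num.max s t * enorm (g (Num.max s t)).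
Proof.
move=> s01 t01; rewrite shrinkE // enormZ // divr_ge0 //; first by lra.
by rewrite le_max; apply/orP; left; lra.
Qed.

Lemma shrink_interior g s t : simple_arc n g -> enorm (g 1) = 1 ->
  0 <= s <= 1 -> 0 < t < 1 -> 0 < enorm (shrink g (s, t)) < 1.
Proof.
move=> sg g1 s01 t01; rewrite enorm_shrink //; last by lra.
set m := Num.max s t.
have m0 : 0 < m by rewrite /m lt_max; apply/orP; right; lra.
have m1 : m <= 1 by rewrite /m ge_max; apply/andP; split; lra.
have tm : t <= m by rewrite /m le_max lexx orbT.
have q0 : 0 < t / m by rewrite divr_gt0 //; lra.
have q1 : t / m <= 1 by rewrite ler_pdivrMr // mul1r.
have [m1'|m1'] := eqVneq m 1; first by rewrite m1' g1 divr1 mulr1.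
have /(arc_interior sg)/andP[e0 e1] : 0 < m < 1 by rewrite m0 lt_neqAle m1'.
rewrite mulr_gt0 //=; apply: le_lt_trans e1.
by rewrite ler_piMl // ltW.
Qed.

(** Both arcs shrink to the same radius; the two homotopies are joined at time
    1/2. *)
Lemma radial_homotopic g d i : simple_arc n g -> simple_arc n d ->
  g 0 = (0, 0) -> d 0 = (0, 0) -> g 1 = rootv i -> d 1 = rootv i ->
  homotopic n g d.
Proof.
move=> sg sd g0 d0 g1 d1.
have cg := continuous_shrink (simple_arc_continuous sg) g0.
have cd := continuous_shrink (simple_arc_continuous sd) d0.
have sh0 f s : f 0 = (0, 0) -> 0 <= s <= 1 -> shrink f (s, 0) = (0, 0).
  by move=> f0 s01; rewrite shrinkE // !mul0r.
have shl f t : f 0 = (0, 0) -> 0 <= t <= 1 -> shrink f (0, t) = f t.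
  move=> f0 t01; have [->|t0] := eqVneq t 0; first by rewrite sh0.
  rewrite shrinkE // max_r; last by lra.
  by rewrite divff // !mul1r; case: (f t).
have shr f t : f 1 = rootv i -> 0 <= t <= 1 ->
    shrink f (1, t) = (t * (rootv i).1, t * (rootv i).2).
  by move=> f1 t01; rewrite shrinkE // max_l ?f1 ?divr1 //; lra.
(* Each half of the time interval freezes one of the two homotopies at the
   common radius, which is subtracted once: joining is an addition, and its
   continuity needs no case distinction. *)
pose H p : R * R :=
  ((shrink g (Num.min (2 * p.1) 1, p.2)).1 + (shrink d (Num.min (2 - 2 * p.1) 1, p.2)).1
     - p.2 * (rootv i).1,
   (shrink g (Num.min (2 * p.1) 1, p.2)).2 + (shrink d (Num.min (2 - 2 * p.1) 1, p.2)).2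
     - p.2 * (rootv i).2).
have HE s t : H (s, t) =
  ((shrink g (Num.min (2 * s) 1, t)).1 + (shrink d (Num.min (2 - 2 * s) 1, t)).1
     - t * (rootv i).1,
   (shrink g (Num.min (2 * s) 1, t)).2 + (shrink d (Num.min (2 - 2 * s) 1, t)).2
     - t * (rootv i).2) by [].
have H1 s t : 0 <= s <= 2^-1 -> 0 <= t <= 1 -> H (s, t) = shrink g (2 * s, t).
  move=> s01 t01; rewrite HE (min_l (_ : 2 * s <= 1)); last by lra.
  rewrite (min_r (_ : 1 <= 2 - 2 * s)); last by lra.
  by rewrite (shr d) // !addrK -surjective_pairing.
have H2 s t : 2^-1 <= s <= 1 -> 0 <= t <= 1 -> H (s, t) = shrink d (2 - 2 * s, t).
  move=> s01 t01; rewrite HE (min_r (_ : 1 <= 2 * s)); last by lra.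
  rewrite (min_l (_ : 2 - 2 * s <= 1)); last by lra.
  by rewrite (shr g) // ![_ + _ - _]addrAC !subrr !add0r -surjective_pairing.
have Hcases (Q : R * R -> Prop) s t : 0 <= s <= 1 -> 0 <= t <= 1 ->
    (forall u, 0 <= u <= 1 -> Q (shrink g (u, t))) ->
    (forall u, 0 <= u <= 1 -> Q (shrink d (u, t))) -> Q (H (s, t)).
  move=> s01 t01 Qg Qd; have [sh|sh] := leP s 2^-1.
    by rewrite H1 //; [apply: Qg; lra | lra].
  by rewrite H2 //; [apply: Qd; lra | lra].
have eg : enorm (g 1) = 1 by rewrite g1 enorm_rootv.
have ed : enorm (d 1) = 1 by rewrite d1 enorm_rootv.
have int f u t : simple_arc n f -> f 0 = (0, 0) -> enorm (f 1) = 1 ->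
    0 <= u <= 1 -> 0 <= t <= 1 -> enorm (shrink f (u, t)) <= 1.
  move=> sf f0 f1 u01 /itv01_cases[->|->|t01].
  - by rewrite sh0 // enorm0.
  - rewrite enorm_shrink // max_r; last by lra.
    by rewrite f1 divr1 mulr1.
  - by have /andP[_ /ltW] := shrink_interior sf f1 u01 t01.
exists H; split.
- apply: continuous_subspaceT; rewrite /H.
  by prove_continuous.
- move=> s t; rewrite !in_itv /= => s01 t01; apply/disk_enorm.
  by apply: (Hcases (fun x => enorm x <= 1)) => // u u01; exact: int.
- move=> t; rewrite in_itv /= => t01; split.
    by rewrite H1 // ?mulr0 ?shl //; lra.
  by rewrite H2 // ?mulr1 ?subrr ?shl //; lra.
- move=> s; rewrite in_itv /= => s01; split.
    by apply: (Hcases (fun x => x = g 0)) => // u u01; rewrite sh0 // g0.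
  have sh1 f u : f 1 = rootv i -> 0 <= u <= 1 -> shrink f (u, 1) = g 1.
    move=> f1 u01; rewrite shrinkE // max_r; last by lra.
    by rewrite divr1 !mul1r f1 g1; case: (rootv i).
  by apply: (Hcases (fun x => x = g 1)) => // u u01; exact: sh1.
- move=> s t; rewrite !in_itv /= => s01 t01; apply: not_vertex.
  have [s01' t01'] : 0 <= s <= 1 /\ 0 <= t <= 1 by lra.
  by apply: (Hcases (fun x => 0 < enorm x < 1)) => // u u01;
    [exact: (shrink_interior sg) | exact: (shrink_interior sd)].
Qed.

(** * Model arcs *)

Definition spoke i t : R * R := (t * cos (root_angle i), t * sin (root_angle i)).

Lemma spoke0 i : spoke i 0 = (0, 0).
Proof. by rewrite /spoke !mul0r. Qed.

Lemma spoke1 i : spoke i 1 = rootv i.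
Proof. by rewrite /spoke !mul1r. Qed.

Lemma enorm_spoke i t : 0 <= t -> enorm (spoke i t) = t.
Proof. exact: enorm_pol. Qed.

Lemma inner_point p : 0 < enorm p < 1 -> disk p /\ ~ circle p /\ ~ vertex n p.
Proof.
move=> pp; split; first by apply/disk_enorm; lra.
split; last exact: not_vertex.
by move/circle_enorm => e; rewrite e ltxx andbF in pp.
Qed.

Lemma spoke_simple i : simple_arc n (spoke i).
Proof.
split.
- by apply: continuous_subspaceT; rewrite /spoke; prove_continuous.
- rewrite spoke0 spoke1; split; apply/vertexP; first by left.
  by right; exists i.
- move=> t; rewrite in_itv /= => t01; apply: inner_point.
  by rewrite enorm_spoke //; lra.
- move=> s t; rewrite !in_itv /= => s01 t01 st /(congr1 (@enorm R)).
  by rewrite !enorm_spoke; lra.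
Qed.

Definition bow_angle i k t : R := root_angle i + t * root_angle k.
Definition bow_radius t : R := 1 - t * (1 - t).
(** The angle grows linearly, so that the arc is simple when it turns at most
    once; the radius bends inwards to leave the boundary circle. *)
Definition bow i k t : R * R :=
  (bow_radius t * cos (bow_angle i k t), bow_radius t * sin (bow_angle i k t)).

Lemma bow_radius_gt0 t : 0 < bow_radius t.
Proof. by rewrite /bow_radius; nra. Qed.

Lemma enorm_bow i k t : enorm (bow i k t) = bow_radius t.
Proof. by rewrite enorm_pol // ltW // bow_radius_gt0. Qed.

Lemma bow_polar i k t : polar (bow i k t) (bow_angle i k t).
Proof. by exists (bow_radius t) => //; exact: bow_radius_gt0. Qed.

Lemma root_angleDk i k : root_angle (i + k) = root_angle i + root_angle k.
Proof. by rewrite /root_angle intrD; ring. Qed.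

Lemma bow_winding i k : winding (bow i k) i k.
Proof.
exists (bow_angle i k); split.
- by rewrite /bow_angle; prove_continuous.
- by move=> t _; exact: bow_polar.
- by rewrite /bow_angle mul0r addr0.
- by rewrite /bow_angle mul1r root_angleDk.
Qed.

Lemma bow_simple i k : 1 <= k <= n%:Z -> simple_arc n (bow i k).
Proof.
move=> /andP[k1 kn]; have k0 : 0 < k by rewrite gtz0_ge1.
split.
- by apply: continuous_subspaceT; rewrite /bow /bow_radius /bow_angle; prove_continuous.
- split; apply/vertexP; right; [exists i | exists (i + k)].
    by rewrite /bow /bow_radius /bow_angle !mul0r subr0 !mul1r addr0.
  by rewrite /bow /bow_radius /bow_angle subrr mulr0 subr0 !mul1r -root_angleDk.
- move=> t; rewrite in_itv /= => t01; apply: inner_point.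
  by rewrite enorm_bow bow_radius_gt0 /= /bow_radius; nra.
- move=> s t; rewrite !in_itv /= => s01 t01 st e.
  have pt := bow_polar i k t; rewrite -e in pt.
  have [c sn] := polar_same pt (bow_polar i k s).
  have [m] := angle_unique c sn; rewrite /bow_angle => em.
  have pi0 := pi_gt0 R.
  have rk : root_angle k = 2 * pi * (k%:~R / n%:R) by rewrite /root_angle mulrA.
  have k0R : (0 : R) < k%:~R / n%:R by rewrite divr_gt0 // ltr0z.
  have k1R : (k%:~R : R) / n%:R <= 1.
    by rewrite ler_pdivrMr // mul1r pmulrn ler_int.
  have em' : (t - s) * (k%:~R / n%:R) = m%:~R :> R.
    apply: (mulfI (_ : 2 * pi != 0)); first by rewrite gt_eqF //; lra.
    by rewrite rk in em; lra.
  have m0 : (0 : R) < m%:~R by rewrite -em' mulr_gt0 // subr_gt0.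
  have m1 : (1 : R) <= m%:~R by rewrite ler1z -gtz0_ge1 -(ltr0z R).
  by rewrite -em' in m1; split; nra.
Qed.

Lemma spokes_disjoint i j : rootv i <> rootv j -> disjoint_arcs (spoke i) (spoke j).
Proof.
move=> ij s t; rewrite !in_itv /= => s01 t01 e.
have := congr1 (@enorm R) e; rewrite !enorm_spoke; try lra.
move=> st; rewrite -st in e *; have [s0|s0] := eqVneq s 0; first by split; left.
by case: ij; case: e => /(mulfI s0) c /(mulfI s0) sn; rewrite /rootv /circle_point c sn.
Qed.

(** They meet only where the arguments agree, that is at a vertex of index
    congruent to [i] on the span of the bow. *)
Lemma spoke_bow_disjoint i j l : (forall m, ~ (j < i + n%:Z * m < j + l)) ->
  1 <= l -> disjoint_arcs (spoke i) (bow j l).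
Proof.
move=> out l1 s t; rewrite !in_itv /= => s01 t01 e.
have := congr1 (@enorm R) e; rewrite enorm_bow enorm_spoke; last by lra.
move=> es; have s0 : 0 < s by rewrite es; exact: bow_radius_gt0.
suff : t = 0 \/ t = 1.
  by move=> t'; split => //; right; rewrite es /bow_radius; case: t' => ->; ring.
have pt := bow_polar j l t; rewrite -e in pt.
have ps : polar (spoke i s) (root_angle i) by exists s.
have [c sn] := polar_same pt ps.
have [m em] := root_angle_mod c sn.
have [->|->|t0] := itv01_cases t01; [by left | by right | exfalso].
have rl : 0 < root_angle l.
  have -> : 0 = root_angle 0 by rewrite /root_angle mulr0 mul0r.
  by rewrite root_angle_lt //; lia.
apply: (out m); rewrite -!root_angle_lt -em root_angleDk /bow_angle.
by apply/andP; split; nra.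
Qed.

(** * The classes of arcs and their disjointness *)

Definition radial_class i : set (R -> R * R) :=
  [set d | simple_arc n d /\ ((d 0 = (0, 0) /\ d 1 = rootv i) \/
                              (d 0 = rootv i /\ d 1 = (0, 0)))].

(** Arcs are unoriented, so the class contains the arcs that wind by [k] from
    [i] in either direction of travel. *)
Definition chord_class i k : set (R -> R * R) :=
  [set d | simple_arc n d /\ (winding d i k \/ winding (reverse d) i k)].

Lemma radial_class_mod i m : radial_class (i + n%:Z * m) = radial_class i.
Proof. by rewrite /radial_class rootv_mod. Qed.

Lemma chord_class_mod i k m : chord_class (i + n%:Z * m) k = chord_class i k.
Proof.
have wm d : winding d (i + n%:Z * m) k <-> winding d i k.
  split=> [/(winding_mod (- m))|]; last exact: winding_mod.
  by rewrite -addrA -mulrDr subrr mulr0 addr0.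
by apply/seteqP; split => d [sd [w|w]]; split => //; rewrite ?wm in w *; auto.
Qed.

Lemma homotopic_ends g d : homotopic n g d -> d 0 = g 0 /\ d 1 = g 1.
Proof.
case=> H [_ _ Hgd Hend _].
have i0 : (0 : R) \in `[0, 1] by rewrite in_itv.
have i1 : (1 : R) \in `[0, 1] by rewrite in_itv.
have [_ <-] := Hgd 0 i0; have [_ <-] := Hgd 1 i1.
by have [] := Hend 1 i1.
Qed.

Lemma arc_class_radial g i : simple_arc n g -> g 0 = (0, 0) -> g 1 = rootv i ->
  arc_class n g = radial_class i.
Proof.
move=> sg g0 g1; apply/seteqP; split => d [sd h]; split => //.
  case: h => /homotopic_ends; rewrite g0 g1; first by left.
  by rewrite /reverse subr0 subrr; right; tauto.
case: h => [[d0 d1]|[d0 d1]]; [left | right].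
  exact: radial_homotopic sg sd g0 d0 g1 d1.
apply: (radial_homotopic (i := i)) => //; first exact: reverse_simple.
  by rewrite /reverse subr0.
by rewrite /reverse subrr.
Qed.

Lemma winding_enorm d i k : simple_arc n d -> winding d i k ->
  enorm (d 0) = 1 /\ enorm (d 1) = 1.
Proof.
by move=> sd wd; rewrite (winding_start sd wd) (winding_end sd wd) !enorm_rootv.
Qed.

Lemma arc_class_chord g i k : simple_arc n g -> winding g i k ->
  arc_class n g = chord_class i k.
Proof.
move=> sg wg; apply/seteqP; split => d [sd h]; split => //.
  case: h => h; [left | right]; first exact: winding_homotopic sg sd wg h.
  exact: winding_homotopic sg (reverse_simple sd) wg h.
have hom f : simple_arc n f -> winding f i k -> homotopic n g f.
  move=> sf wf; have [g0 g1] := winding_enorm sg wg; have [f0 f1] := winding_enorm sf wf.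
  case: wg => th [ct pth th0 th1]; case: wf => th' [ct' pth' th'0 th'1].
  apply: (polar_homotopic sg (simple_arc_continuous sf) _ ct ct' pth pth').
  - by move=> t; exact: (arc_enorm sf).
  - by rewrite th0.
  - by rewrite th1.
  - by rewrite g0.
  - by rewrite g1.
by case: h => h; [left | right]; apply: hom => //; exact: reverse_simple.
Qed.

Lemma radial_is_arc_class i : is_arc_class n (radial_class i).
Proof.
exists (spoke i); split; first exact: spoke_simple.
- move=> [[p _ /homotopic_ends[/= p0 p1]]|[k _ h]].
    by apply: (@rootv_neq0 i); rewrite -(spoke1 i) -p1 p0 spoke0.
  have e1 t : enorm (edge n k t : R * R) = 1 by exact: enorm_circle_point.
  case: h => /homotopic_ends[+ _]; rewrite spoke0 => e; have := @enorm0 R;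
    rewrite -e; first by rewrite e1; lra.
  by rewrite /reverse e1; lra.
- by rewrite (@arc_class_radial _ i) ?spoke0 ?spoke1 //; exact: spoke_simple.
Qed.

Lemma loop_trivial g : simple_arc n g -> g 0 = (0, 0) -> g 1 = (0, 0) -> trivial_arc n g.
Proof.
move=> sg g0 g1; left; exists (0, 0); first by left.
have cg := simple_arc_continuous sg.
exists (fun p => ((1 - p.1) * (g (clamp p.2)).1, (1 - p.1) * (g (clamp p.2)).2)); split.
- apply: continuous_subspaceT.
  have c2 : continuous (fun p : R * R => g (clamp p.2)).
    exact: continuous_compose (continuous_sndf continuous_idf) cg.
  by prove_continuous.
- move=> s t; rewrite !in_itv /= => s01 t01; apply/disk_enorm.
  rewrite clamp_id // enormZ; last by lra.
  by have := arc_enorm sg t01; have := enorm_ge0 (g t); nra.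
- move=> t; rewrite in_itv /= => t01; rewrite clamp_id //.
  by rewrite subr0 !mul1r subrr !mul0r -surjective_pairing.
- by move=> s _; rewrite /= !clamp_id // g0 g1 /= !mulr0.
- move=> s t; rewrite !in_itv /= => s01 t01; apply: not_vertex.
  rewrite clamp_id; last by lra.
  by rewrite enormZ; last lra; have := arc_interior sg t01; nra.
Qed.

Lemma winding0_trivial g i : simple_arc n g -> winding g i 0 -> trivial_arc n g.
Proof.
move=> sg wg; have [g0 g1] := winding_enorm sg wg.
case: wg => th [ct pth th0 th1]; left; exists (rootv i).
  by apply/vertexP; right; exists i.
apply: (polar_homotopic sg (th' := fun=> root_angle i) _ _ ct _ pth).
- exact: cst_continuous.
- by move=> t _; rewrite enorm_rootv.
- exact: cst_continuous.
- by move=> t _; exact: polar_circle_point.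
- by rewrite th0.
- by rewrite th1 addr0.
- by rewrite enorm_rootv g0.
- by rewrite enorm_rootv g1.
Qed.

Lemma chord_residue i k : 1 <= k <= n%:Z -> exists a b : nat,
  [/\ (1 <= a <= n)%N, (1 <= b <= n)%N & chord_class i k = chord_class a%:Z b%:Z].
Proof.
move=> k1; have [a an [m ->]] := residue n0 i; exists a, `|k|%N; split => //; first by lia.
by rewrite chord_class_mod; congr chord_class; lia.
Qed.

(** A list that contains all vertices of the complex.  It also contains the
    classes of the edges, which the dismantling skips. *)
Lemma arc_class_cases (c : set (R -> R * R)) : is_arc_class n c ->
  (exists2 a : nat, (1 <= a <= n)%N & c = radial_class a%:Z) \/
  (exists a b : nat, [/\ (1 <= a <= n)%N, (1 <= b <= n)%N & c = chord_class a%:Z b%:Z]).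
Proof.
case=> g [sg ntg ->].
have rad f i : simple_arc n f -> f 0 = (0, 0) -> f 1 = rootv i ->
    exists2 a : nat, (1 <= a <= n)%N & arc_class n f = radial_class a%:Z.
  move=> sf f0 f1; have [a an [m im]] := residue n0 i; exists a => //.
  by rewrite (@arc_class_radial _ i) // im radial_class_mod.
case: (sg) => _ [/vertexP v0 /vertexP v1] _ _.
case: v0 v1 => [g0|[i g0]] [g1|[j g1]].
- by case: ntg; exact: loop_trivial.
- by left; exact: rad sg g0 g1.
- left; rewrite -arc_class_reverse; apply: (rad _ i) => //.
  + exact: reverse_simple.
  + by rewrite /reverse subr0.
  + by rewrite /reverse subrr.
right; have [k wk] := winding_exists sg g0 g1.
have [k0|k0|k0] := ltgtP k 0; last by case: ntg; rewrite k0 in wk; exact: winding0_trivial wk.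
  rewrite -arc_class_reverse.
  have sr := reverse_simple sg; have wr := winding_reverse wk.
  rewrite (arc_class_chord sr wr); apply: chord_residue.
  by have := winding_le sr wr; lia.
rewrite (arc_class_chord sg wk); apply: chord_residue.
by have := winding_le sg wk; lia.
Qed.

Lemma spoke_in i : radial_class i (spoke i).
Proof. by split; [exact: spoke_simple | left; rewrite spoke0 spoke1]. Qed.

Lemma radial_neq_chord i j l : radial_class i <> chord_class j l.
Proof.
move=> e; have := spoke_in i; rewrite e => -[ss [|]] w.
  by have [] := winding_enorm ss w; rewrite spoke0 enorm0; lra.
have [_] := winding_enorm (reverse_simple ss) w.
by rewrite /reverse subrr spoke0 enorm0; lra.
Qed.

Lemma radial_class_inj (a b : nat) : (1 <= a <= n)%N -> (1 <= b <= n)%N ->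
  radial_class a%:Z = radial_class b%:Z -> a = b.
Proof.
move=> an bn e; have := spoke_in a%:Z; rewrite e => -[_ [[_ h]|[h _]]]; last first.
  by case: (@rootv_neq0 b%:Z); rewrite -h spoke0.
suff : a%:Z = b%:Z by lia.
by apply: rootv_inj ; [lia | lia | rewrite -h spoke1].
Qed.

Lemma radials_disjoint (a b : nat) : (1 <= a <= n)%N -> (1 <= b <= n)%N -> a <> b ->
  disjoint_classes (radial_class a%:Z) (radial_class b%:Z).
Proof.
move=> an bn ab; exists (spoke a%:Z), (spoke b%:Z).
split; [exact: spoke_in | exact: spoke_in |].
apply: spokes_disjoint => e; apply: ab; suff : a%:Z = b%:Z by lia.
by apply: rootv_inj => //; lia.
Qed.

Lemma radial_chord_disjoint i j l : 1 <= l <= n%:Z ->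
  (forall m, ~ (j < i + n%:Z * m < j + l)) ->
  disjoint_classes (radial_class i) (chord_class j l).
Proof.
move=> l1 out; exists (spoke i), (bow j l); split; first exact: spoke_in.
  by split; [exact: bow_simple | left; exact: bow_winding].
by apply: spoke_bow_disjoint => //; lia.
Qed.

Lemma chords_nest i k j l m : disjoint_classes (chord_class i k) (chord_class j l) ->
  l <= k -> ~ (j < i + n%:Z * m < j + l).
Proof.
case=> g [d [[sg wg] [sd wd] gd]] lk.
wlog wg' : g sg wg gd / winding g i k.
  move=> W; case: (wg) => w; first exact: W w.
  apply: (W (reverse g)) => //; [exact: reverse_simple | by left |].
  exact: disjoint_arcs_reverse.
wlog wd' : d sd wd gd / winding d j l.
  move=> W; case: (wd) => w; first exact: W w.
  apply: (W (reverse d)) => //; [exact: reverse_simple | by left |].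
  by apply: disjoint_arcs_sym; apply: disjoint_arcs_reverse; exact: disjoint_arcs_sym.
exact: windings_nest sg sd (winding_mod m wg') wd' gd lk.
Qed.

(** * The order of the collapses *)

Lemma arc_complex_cone (s : set (set (R -> R * R))) (w : set (R -> R * R)) :
  simplex (arc_complex R n) s -> is_arc_class n w ->
  (forall c, s c -> c = w \/ disjoint_classes w c) ->
  simplex (arc_complex R n) (w |` s).
Proof.
move=> [fs _ sA sD] wA wD; split.
- by rewrite finite_setU; split.
- by exists w; left.
- by move=> c [->|/sA].
move=> c1 c2 [->|s1] [->|s2] c12 //.
- by case: (wD c2 s2) => // e; case: c12.
- by case: (wD c1 s1) => // h; exact: disjoint_classes_sym.
- exact: sD.
Qed.

Let radial (a : nat) : set (R -> R * R) := radial_class a%:Z.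
Let chord (a b : nat) : set (R -> R * R) := chord_class a%:Z b%:Z.

(** The n * n chord classes by decreasing winding, then the radial classes other
    than the first. *)
Definition collapse_order (k : nat) : set (R -> R * R) :=
  if (k < n * n)%N then chord (k %% n).+1 (n - k %/ n) else radial (k - n * n).+2.

Lemma collapse_order_chord (a b : nat) : (1 <= a <= n)%N -> (1 <= b <= n)%N ->
  exists k : nat, [/\ (k < n * n)%N, collapse_order k = chord a b & (k %/ n = n - b)%N].
Proof.
move=> an bn; exists ((n - b) * n + a.-1)%N.
have a1 : (a.-1 < n)%N by lia.
have d : (((n - b) * n + a.-1) %/ n = n - b)%N by rewrite divnMDl // divn_small // addn0.
have lt : ((n - b) * n + a.-1 < n * n)%N by nia.
split=> //; rewrite /collapse_order lt d modnMDl modn_small //.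
by congr chord; lia.
Qed.

(** Among the classes disjoint from a longest chord starting at [a], none
    separates the centre from the vertex [a]. *)
Lemma radial_dominates (a b : nat) (s : set (set (R -> R * R))) c : (1 <= a <= n)%N -> (1 <= b <= n)%N ->
  simplex (arc_complex R n) s -> s (chord a b) ->
  (forall a' b', (1 <= a' <= n)%N -> (b < b' <= n)%N -> ~ s (chord a' b')) ->
  s c -> c = radial a \/ disjoint_classes (radial a) c.
Proof.
move=> an bn [_ _ sA sD] sab smax sc.
have [[a' an' ce]|[a' [b' [an' bn' ce]]]] := arc_class_cases (sA c sc).
  rewrite ce; have [->|/eqP aa'] := eqVneq a a'; first by left.
  by right; exact: radials_disjoint.
right; rewrite ce; have bb' : (b' <= b)%N.
  rewrite leqNgt; apply/negP => lt.
  by apply: (smax a' b'); [exact: an' | lia | rewrite ce in sc].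
have [e|ne] := pselect (chord a b = chord a' b').
  rewrite -/(chord a' b') -e; apply: radial_chord_disjoint; first by lia.
  move=> m; have [m0|[m0|m0]] : m = 0 \/ m <= -1 \/ 1 <= m by lia.
  - by rewrite m0; lia.
  - have : n%:Z * m <= - n%:Z by nia.
    lia.
  - have : n%:Z <= n%:Z * m by nia.
    lia.
apply: radial_chord_disjoint; first by lia.
move=> m; apply: (chords_nest (k := b%:Z)); last by lia.
by apply: sD => //; rewrite ce in sc.
Qed.

End Crown.

Theorem theorem1 (R : realType) (n : nat) (hn : (1 <= n)%N) :
  strongly_collapsible (arc_complex R n).
Proof.
apply: (@dismantle _ _ (@collapse_order R n) (n * n + n.-1) (radial_class n 1%:Z)).
- move=> s v [_ _ sA _] /sA /(arc_class_cases hn)[[a an ->]|[a [b [an bn ->]]]].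
    have [->|a1] := eqVneq a 1%N; first by left.
    right; exists (n * n + (a - 2))%N; first by lia.
    rewrite /collapse_order ltnNge leq_addr /= addKn.
    by congr radial_class; lia.
  right; have [k [kn <- _]] := collapse_order_chord (R := R) hn an bn.
  by exists k => //; lia.
- split; [exact: finite_set1 | by exists (radial_class n 1%:Z) | |].
    by move=> _ ->; exact: radial_is_arc_class.
  by move=> _ _ -> ->.
- move=> k km; rewrite /collapse_order; case: ifP => kn e.
    exact: (radial_neq_chord hn (esym e)).
  by have := radial_class_inj hn _ _ e; lia.
- move=> k km; have [kn|kn] := ltnP k (n * n).
    pose a := (k %% n).+1; pose b := (n - k %/ n)%N.
    have kd : (k %/ n < n)%N by rewrite ltn_divLR.
    have an : (1 <= a <= n)%N by rewrite /a ltn_mod hn.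
    have bn : (1 <= b <= n)%N by rewrite /b leq_subr andbT subn_gt0.
    have ke : collapse_order n k = chord_class n a%:Z b%:Z :> set (R -> R * R).
      by rewrite /collapse_order kn.
    exists (radial_class n a%:Z); split.
      by rewrite ke; exact: radial_neq_chord.
    move=> s Xs smax; rewrite ke => sk; split; last first.
      move=> j jk; rewrite /collapse_order (ltn_trans jk kn).
      exact: radial_neq_chord.
    apply: arc_complex_cone => //; first exact: radial_is_arc_class.
    move=> c; apply: (radial_dominates hn an bn Xs sk) => a' b' an' bn'.
    have bn1 : (1 <= b' <= n)%N by move: bn'; clear; lia.
    have [j [jn <- jd]] := collapse_order_chord (R := R) hn an' bn1.
    apply: smax; rewrite ltnNge; apply/negP => kj.
    by have := leq_div2r n kj; rewrite jd -/b; move: bn'; rewrite /b; move: (k %/ n)%N => q; lia.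
  have kE (j : nat) : (n * n <= j)%N ->
      collapse_order n j = radial_class n (j - n * n).+2%:Z :> set (R -> R * R).
    by rewrite leqNgt /collapse_order => /negbTE ->.
  exists (radial_class n 1%:Z); split.
    by rewrite kE // => e; have := radial_class_inj hn _ _ e; lia.
  move=> s Xs smax sk; split; last first.
    move=> j jk; have [jn|jn] := ltnP j (n * n).
      by rewrite /collapse_order jn; exact: radial_neq_chord.
    by rewrite kE // => e; have := radial_class_inj hn _ _ e; lia.
  apply: arc_complex_cone => //; first exact: radial_is_arc_class.
  move=> c sc; case: (Xs) => _ _ sA _.
  have [[a an ce]|[a [b [an bn ce]]]] := arc_class_cases hn (sA c sc).
    have [a1|a1] := eqVneq a 1%N; first by left; rewrite ce a1.
    by right; rewrite ce; apply: radials_disjoint => //; lia.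
  have [j [jn je _]] := collapse_order_chord (R := R) hn an bn.
  by case: (smax j); [lia | rewrite je -ce].
Qed.
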